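(* It is NP-hard to approximate $\operatorname{FR}_{\min}(W)$ to additive error $$\delta_N=\frac{1}{256N^{7/2}}$$ for a nonzero nonnegative integer weighted adjacency matrix $W$ of order $N$, with its entries given in binary. This remains true when the support graph of $W$ is connected, $N$ is odd, and all positive weights belong to $\{1,M\}$ for one integer $M\le N^2$. The same obstruction applies to exact computation of $\operatorname{FR}_{\min}(W)$ whenever the exact output permits this additive approximation to be obtained in polynomial time.
   Context: A weighted adjacency matrix $W=(w_{uv})_{u,v\in V}$ of order $N=|V|$ is a symmetric matrix with nonnegative entries and zero diagonal. Its support graph has vertex set $V$ and an edge $\{u,v\}$ exactly when $w_{uv}>0$. A labeling is a bijection $\pi:\mathbb{Z}_N\to V$, and $W_\pi$ is the matrix indexed by $\mathbb{Z}_N$ with entries $W_\pi(x,y)=w_{\pi(x)\pi(y)}$. Let $F_N(r,x)=\frac{1}{\sqrt N}e^{-2\pi i rx/N}$ for $r,x\in\mathbb{Z}_N$. For a matrix $C$, $\|C\|_1=\sum_{r,v}|C_{rv}|$ and $\|C\|_2=(\sum_{r,v}|C_{rv}|^2)^{1/2}$. For $W\ne0$, $\operatorname{FR}_{\min}(W)=\min_\pi\frac{\|F_NW_\pi F_N\|_1}{\|F_NW_\pi F_N\|_2}$, the minimum over all labelings. Additive approximation with error $\delta$ means returning a rational value whose distance from the requested real value is at most $\delta$. NP-hardness of this numerical problem means that a polynomial-time approximation algorithm would decide an NP-complete problem in polynomial time. The NP-complete problem used (a known result of Lubiw, which may be assumed) is: given a simple graph $H$, decide whether $H$ has a fixed-point-free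 involutory automorphism, i.e. an automorphism $\tau$ with $\tau^2=\mathrm{id}$ and $\tau(v)\neq v$ for every vertex $v$. *)

(* Defs.v *)
From HB Require Import structures.
From Stdlib Require Import BinNums.
From mathcomp Require Import all_boot all_order all_algebra all_fingroup.
From mathcomp Require Import all_classical all_reals all_analysis.
From mathcomp Require Import complex.

Set Implicit Arguments.
Unset Strict Implicit.
Unset Printing Implicit Defensive.

Import Order.TTheory GRing.Theory Num.Theory.
Local Open Scope ring_scope.

(* The model of computation is a deterministic multi-stack machine given by a
   structured program.  A program mentions finitely many registers; each holds
   a stack of bits, and every push, pop or emptiness test costs one step.  Two
   stacks are the two halves of a Turing machine tape, and a stack is a
   one-sided tape, so running times agree with those of multi-tape Turing
   machines up to a constant factor (depending on the program). *)

Inductive cmd : Type :=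
| Skip
| Push of nat & bool
| Seq of cmd & cmd
(* [Pop r c0 cf ct] runs [c0] if register [r] is empty; otherwise it removes
   the top bit of [r] and runs [cf] or [ct] according to that bit. *)
| Pop of nat & cmd & cmd & cmd
(* [While r c] repeats [c] as long as register [r] is nonempty. *)
| While of nat & cmd.

Definition store := nat -> seq bool.

Definition upd (s : store) (r : nat) (w : seq bool) : store :=
  fun q => if q == r then w else s q.

Inductive exec : cmd -> store -> nat -> store -> Prop :=
| exec_skip s : exec Skip s 1 s
| exec_push r b s : exec (Push r b) s 1 (upd s r (b :: s r))
| exec_seq c1 c2 s1 s2 s3 t1 t2 :
    exec c1 s1 t1 s2 -> exec c2 s2 t2 s3 -> exec (Seq c1 c2) s1 (t1 + t2)%N s3
| exec_pop_nil r c0 cf ct s t s' :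
    s r = [::] -> exec c0 s t s' -> exec (Pop r c0 cf ct) s t.+1 s'
| exec_pop_cons r c0 cf ct s b w t s' :
    s r = b :: w -> exec (if b then ct else cf) (upd s r w) t s' ->
    exec (Pop r c0 cf ct) s t.+1 s'
| exec_while_nil r c s : s r = [::] -> exec (While r c) s 1 s
| exec_while_cons r c s1 s2 s3 t1 t2 :
    s1 r <> [::] -> exec c s1 t1 s2 -> exec (While r c) s2 t2 s3 ->
    exec (While r c) s1 (t1 + t2).+1 s3.

Definition init (x : seq bool) : store := fun r => if r == 0%N then x else [::].

Definition poly_bound (k n : nat) : nat := (k * n ^ k + k)%N.

(* On input [x], placed in register 0, the program [c] halts within
   [poly_bound k (size x)] steps with [y] in register 0. *)
Definition runs (c : cmd) (k : nat) (x y : seq bool) : Prop :=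
  exists t s, [/\ exec c (init x) t s, (t <= poly_bound k (size x))%N & s 0%N = y].

Definition polytime (f : seq bool -> seq bool) : Prop :=
  exists c k, forall x, runs c k x (f x).

Definition language := seq bool -> Prop.

Definition in_P (L : language) : Prop :=
  exists2 f, polytime f & forall x, L x <-> f x = [:: true].

(* Self-delimiting code: each bit is preceded by [true]; [false] ends. *)
Definition delim (w : seq bool) : seq bool :=
  flatten [seq [:: true; b] | b <- w] ++ [:: false].

Definition enc_pair (x y : seq bool) : seq bool := delim x ++ y.

Definition in_NP (L : language) : Prop :=
  exists2 V : language, in_P V &
    exists k, forall x, L x <->
      exists2 y, (size y <= poly_bound k (size x))%N & V (enc_pair x y).

Definition NP_complete (L : language) : Prop :=
  in_NP L /\
  forall L', in_NP L' -> exists2 f, polytime f & forall x, L' x <-> L (f x).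

(* [solvable] is the assertion that a numerical problem admits a
   polynomial-time algorithm. *)
Definition NP_hard (solvable : Prop) : Prop :=
  exists2 L, NP_complete L & solvable -> in_P L.

(* Binary digits, least significant first. *)
Fixpoint pos_bits (p : positive) : seq bool :=
  match p with
  | xH => [:: true]
  | xO q => false :: pos_bits q
  | xI q => true :: pos_bits q
  end.

Definition nat_bits (n : nat) : seq bool :=
  if bin_of_nat n is Npos p then pos_bits p else [::].

Definition enc_nat (n : nat) : seq bool := delim (nat_bits n).

(* The code of the (not necessarily reduced) fraction [a / d]. *)
Definition enc_frac (a : int) (d : nat) : seq bool :=
  (a < 0) :: enc_nat `|a|%N ++ enc_nat d.

(* The order in unary, then the entries row by row. *)
Definition enc_mx (N : nat) (W : 'M[nat]_N) : seq bool :=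
  nseq N true ++ false ::
    flatten [seq enc_nat (W u v) | u <- enum 'I_N, v <- enum 'I_N].

Definition enc_graph (n : nat) (e : rel 'I_n) : seq bool :=
  nseq n true ++ false :: [seq e u v | u <- enum 'I_n, v <- enum 'I_n].

Definition fpf_involutory_automorphism (n : nat) (e : rel 'I_n) (tau : 'S_n) :=
  [/\ forall u v, e (tau u) (tau v) = e u v,
      forall v, tau (tau v) = v
    & forall v, tau v != v].

Definition fpf_involution_problem : language := fun x =>
  exists n (e : rel 'I_n),
    [/\ symmetric e, irreflexive e, x = enc_graph e
      & exists tau : 'S_n, fpf_involutory_automorphism e tau].

Definition support (N : nat) (W : 'M[nat]_N) : rel 'I_N :=
  fun u v => (0 < W u v)%N.

Definition mx_class := forall N : nat, 'M[nat]_N -> Prop.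

Definition weighted_adjacency : mx_class := fun N W =>
  [/\ forall u v, W u v = W v u, forall u, W u u = 0%N
    & exists u v, W u v <> 0%N].

Definition restricted_adjacency : mx_class := fun N W =>
  [/\ weighted_adjacency W,
      forall u v, connect (support W) u v,
      odd N
    & exists2 M : nat, (M <= N ^ 2)%N &
        forall u v, (0 < W u v)%N -> W u v = 1%N \/ W u v = M].

Section Fourier.
Variable R : realType.

Definition norm1 (m n : nat) (C : 'M[R[i]]_(m, n)) : R :=
  \sum_r \sum_v ComplexField.Normc.normc (C r v).

Definition norm2 (m n : nat) (C : 'M[R[i]]_(m, n)) : R :=
  Num.sqrt (\sum_r \sum_v ComplexField.Normc.normc (C r v) ^+ 2).

(* exp (i * theta) *)
Definition cis (theta : R) : R[i] := Complex (cos theta) (sin theta).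

Definition dft (N : nat) : 'M[R[i]]_N :=
  \matrix_(r, x) (real_complex R (Num.sqrt N%:R)^-1 *
                  cis (- (2 * pi * (r * x)%:R / N%:R))).

(* The residues modulo [N] and the vertices are both represented by ['I_N], so
   that a labeling is a permutation of ['I_N]. *)
Definition relabel (N : nat) (W : 'M[nat]_N) (p : 'S_N) : 'M[R[i]]_N :=
  \matrix_(x, y) (W (p x) (p y))%:R.

Definition FR (N : nat) (W : 'M[nat]_N) (p : 'S_N) : R :=
  let C := dft N *m relabel W p *m dft N in norm1 C / norm2 C.

Definition FRmin (N : nat) (W : 'M[nat]_N) : R :=
  \big[Num.min/FR W 1%g]_(p : 'S_N) FR W p.

Definition delta (N : nat) : R := (256 * N%:R `^ (7 / 2))^-1.

(* The string [y] encodes a rational number within [delta N] of [FRmin W]. *)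
Definition approximates (N : nat) (W : 'M[nat]_N) (y : seq bool) : Prop :=
  exists a d, [/\ (0 < d)%N, y = enc_frac a d
                & `|a%:~R / d%:R - FRmin W| <= delta N].

(* Algorithms are only required to work on matrices in the class [K]; nothing
   is asked of them on other inputs. *)

Definition approximable (K : mx_class) : Prop :=
  exists c k, forall N (W : 'M[nat]_N), K N W ->
    exists2 y, runs c k (enc_mx W) y & approximates W y.

(* Exact computation depends on how real numbers are written: a notation
   [den] sends a string to the real number it denotes, if any. *)
Definition exactly_computable (den : seq bool -> option R) (K : mx_class) :=
  exists c k, forall N (W : 'M[nat]_N), K N W ->
    exists2 z, runs c k (enc_mx W) z & den z = Some (FRmin W).

Definition permits_approximation (den : seq bool -> option R) (K : mx_class) :=
  exists c k, forall N (W : 'M[nat]_N) z, K N W -> den z = Some (FRmin W) ->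
    exists2 y, runs c k (enc_pair (enc_mx W) z) y & approximates W y.

End Fourier.

(* Main.v *)
(* The cone over a graph on an even number [n] of vertices, all its new edges
   having weight [M = N ^ 2] with [N = n + 1], is labelled with its apex at [0]
   (a translation only changes the phases of the transform).  Let [D] be [N]
   times its transform.  Since [M] is large, the real part of [D] is positive on
   the two axes and negative elsewhere, whatever the labeling, and the sum of the
   real parts with these signs is a number [A] which depends only on [N] and on
   the number of edges.  Hence [N * norm1 >= A], with equality exactly when [D]
   is real, that is when [x |-> - x] preserves the labelled graph; as [N] is odd,
   this reflection is then an involutory automorphism fixing the apex only.
   Otherwise Parseval's identity bounds the energy of the imaginary part of [D]
   off the axes from below, and as [D] is only of size [O(N ^ 2)] there,
   [N * norm1] exceeds [A] by at least 1/64; this gap survives an error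
   [delta N] on the ratio.

   Polynomial-time programs are not written by hand but obtained from closure
   properties of the functions [f] such that [PT f]: a program leaves its inputs
   in the lower registers, as a typed context, and writes its value in the next
   register, so that composition only shifts registers. *)
From Corelib Require Import PosDef.
Require Import Defs.
From mathcomp Require Import all_boot all_order all_algebra all_fingroup all_reals.
From mathcomp Require Import boolp topology normedtype trigo exp complex.
From mathcomp Require Import zify ring lra.

Set Implicit Arguments.
Unset Strict Implicit.
Unset Printing Implicit Defensive.

Import Order.TTheory GRing.Theory Num.Theory ComplexField.Normc.
Local Open Scope nat_scope.

(** * Programs *)

(** By Parseval's identity [norm2] is the same for all labelings, so only [norm1] matters, and the
    obstacle is to bound it from below for all labelings at once. The bound is by duality: the sum
    of the real parts with fixed signs is a linear functional of the weights, given by the transform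
    of the sign pattern. This transform is constant off the axes, so the graph enters only through
    its number of edges. A non-real value exceeds its real part by about the squared imaginary part
    divided by the modulus, so the gap has to be found where [D] is small. On the axes [D] is of
    order [N ^ 3] and an imaginary part gains too little; hence the need for energy off the axes,
    which is exhibited by removing row and column averages. The exponent 7/2 is that of [N * norm2]:
    the weight [N ^ 2] on about [2 N] entries gives a [norm2] of order [N ^ (5/2)], so that an error
    [delta N] on the ratio becomes a small constant on [N * norm1]. *)

Notation bits := (seq bool).

(** Time is only bounded above, so that branches of unequal cost and iterated bodies compose by
    adding bounds. *)
Definition execb (c : cmd) (s : store) (b : nat) (s' : store) : Prop :=
  exists2 t, t <= b & exec c s t s'.

Lemma execb_exec c s t s' : exec c s t s' -> execb c s t s'.
Proof. by exists t. Qed.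

Lemma execb_le c s b b' s1 s2 :
  execb c s b s1 -> b <= b' -> s1 = s2 -> execb c s b' s2.
Proof. by case=> t tb ex bb' <-; exists t => //; apply: leq_trans bb'. Qed.

Lemma execb_seq c1 c2 s1 s2 s3 b1 b2 :
  execb c1 s1 b1 s2 -> execb c2 s2 b2 s3 -> execb (Seq c1 c2) s1 (b1 + b2) s3.
Proof.
case=> t1 h1 e1 [t2 h2 e2]; exists (t1 + t2); first exact: leq_add.
exact: exec_seq e1 e2.
Qed.

Lemma execb_push r b s : execb (Push r b) s 1 (upd s r (b :: s r)).
Proof. exact/execb_exec/exec_push. Qed.

Lemma execb_pop_nil r c0 cf ct s b s' :
  s r = [::] -> execb c0 s b s' -> execb (Pop r c0 cf ct) s b.+1 s'.
Proof. by move=> sr [t tb ex]; exists t.+1 => //; apply: exec_pop_nil. Qed.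

Lemma execb_pop_cons r c0 cf ct s x w b s' :
  s r = x :: w -> execb (if x then ct else cf) (upd s r w) b s' ->
  execb (Pop r c0 cf ct) s b.+1 s'.
Proof. by move=> sr [t tb ex]; exists t.+1 => //; apply: exec_pop_cons sr ex. Qed.

Lemma execb_while_nil r c s : s r = [::] -> execb (While r c) s 1 s.
Proof. by move=> sr; apply/execb_exec/exec_while_nil. Qed.

Lemma execb_while_cons r c s1 s2 s3 b1 b2 :
  s1 r <> [::] -> execb c s1 b1 s2 -> execb (While r c) s2 b2 s3 ->
  execb (While r c) s1 (b1 + b2).+1 s3.
Proof.
move=> sr [t1 h1 e1] [t2 h2 e2]; exists (t1 + t2).+1.
  by rewrite ltnS leq_add.
exact: exec_while_cons e1 e2.
Qed.

(** A step pushes at most one bit. Hence polynomial time forces polynomial output size, and bounds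
    whatever a program leaves behind in its registers. *)
Lemma exec_size c s t s' r : exec c s t s' -> size (s' r) <= size (s r) + t.
Proof.
move=> ex; elim: ex => {c s t s'} /=.
- by move=> *; lia.
- by move=> q b s; rewrite /upd; case: eqP => [->|] /=; lia.
- by move=> *; lia.
- by move=> *; lia.
- by move=> q c0 cf ct s b w t s' sq _; rewrite /upd; case: eqP => [->|];
    rewrite ?sq /=; lia.
- by move=> *; lia.
- by move=> *; lia.
Qed.

Lemma updE s a w : upd s a w a = w.
Proof. by rewrite /upd eqxx. Qed.

Lemma updN s a q w : q != a -> upd s a w q = s q.
Proof. by rewrite /upd => /negbTE ->. Qed.

Lemma upd_id s a w : s a = w -> upd s a w = s.
Proof. by move=> <-; apply: funext => q; rewrite /upd; case: eqP => [->|]. Qed.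

Lemma upd_upd s a v w : upd (upd s a v) a w = upd s a w.
Proof. by apply: funext => q; rewrite /upd; case: eqP. Qed.

Ltac store_eq :=
  apply: funext => ?; rewrite /upd; repeat case: eqP => ?; subst;
  rewrite ?catrevE ?cats0 ?revK //; try lia.

Definition clear (a : nat) : cmd := While a (Pop a Skip Skip Skip).

Lemma exec_clear a s :
  execb (clear a) s (3 * size (s a)).+1 (upd s a [::]).
Proof.
move: {2}(s a) (erefl (s a)) => w; elim: w s => [|x w IH] s sa.
  by rewrite (upd_id sa) sa; apply: execb_while_nil.
have := IH (upd s a w); rewrite updE upd_upd => /(_ erefl) {}IH.
apply: execb_le (execb_while_cons _ _ IH) _ erefl.
- by rewrite sa.
- apply: execb_pop_cons sa _; case: x; exact/execb_exec/exec_skip.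
- rewrite sa /=; lia.
Qed.

Definition move_rev (a b : nat) : cmd :=
  While a (Pop a Skip (Push b false) (Push b true)).

Lemma exec_move_rev a b s : a != b ->
  execb (move_rev a b) s (3 * size (s a)).+1
        (upd (upd s a [::]) b (catrev (s a) (s b))).
Proof.
move=> ab; move: {2}(s a) (erefl (s a)) => w; elim: w s => [|x w IH] s sa.
  rewrite (upd_id sa) sa [upd _ _ _]upd_id //; exact: execb_while_nil.
have := IH (upd (upd s a w) b (x :: s b)).
rewrite updN // !updE => /(_ erefl) {}IH.
apply: execb_le (execb_while_cons _ _ IH) _ _.
- by rewrite sa.
- apply: execb_pop_cons sa _.
  have h := execb_push b x (upd s a w).
  rewrite updN 1?eq_sym // in h; case: x {IH} h => h; exact: h.
- rewrite sa /=; lia.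
- rewrite sa /=; store_eq.
Qed.

Definition move_rev2 (a b c : nat) : cmd :=
  While a (Pop a Skip (Seq (Push b false) (Push c false))
                      (Seq (Push b true) (Push c true))).

Lemma exec_move_rev2 a b c s : a != b -> a != c -> b != c ->
  execb (move_rev2 a b c) s (4 * size (s a)).+1
        (upd (upd (upd s a [::]) b (catrev (s a) (s b))) c
             (catrev (s a) (s c))).
Proof.
move=> ab ac bc; move: {2}(s a) (erefl (s a)) => w.
elim: w s => [|x w IH] s sa.
  rewrite (upd_id sa) sa [upd s b _]upd_id // [upd _ _ _]upd_id //.
  exact: execb_while_nil.
have := IH (upd (upd (upd s a w) b (x :: s b)) c (x :: s c)).
rewrite updN // updN // updE => /(_ erefl) {}IH.
apply: execb_le (execb_while_cons _ _ IH) _ _.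
- by rewrite sa.
- apply: execb_pop_cons sa _.
  have h1 := execb_push b x (upd s a w).
  have h2 := execb_push c x (upd (upd s a w) b (x :: s b)).
  rewrite updN 1?eq_sym // in h1.
  rewrite updN 1?eq_sym // updN 1?eq_sym // in h2.
  by case: x {IH} h1 h2 => h1 h2; exact: execb_seq h1 h2.
- rewrite sa /=; lia.
- rewrite sa /=; store_eq.
Qed.

(** Reading a stack empties it: the word is reversed into the scratch register [d.+1], then reversed
    back into [a] and [d] together. *)
Definition copy (a d : nat) : cmd := Seq (move_rev a d.+1) (move_rev2 d.+1 a d).

Lemma exec_copy a d s : a < d -> s d = [::] -> s d.+1 = [::] ->
  execb (copy a d) s (7 * size (s a) + 2) (upd s d (s a)).
Proof.
move=> ad sd sd1.
have h1 := @exec_move_rev a d.+1 s ltac:(lia).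
have h2 := @exec_move_rev2 d.+1 a d _ ltac:(lia) ltac:(lia) ltac:(lia).
apply: execb_le (execb_seq h1 (h2 _)) _ _.
- by rewrite updE sd1 catrevE cats0 size_rev; lia.
- by rewrite sd1; store_eq; rewrite sd cats0.
Qed.

(** Replaces an argument in register [d] by the value just computed from it in [d.+1]; two reversals
    through [d.+2] keep the order of the bits. *)
Definition slide (d : nat) : cmd :=
  Seq (clear d) (Seq (move_rev d.+1 d.+2) (move_rev d.+2 d)).

Lemma exec_slide d s : s d.+2 = [::] ->
  execb (slide d) s (3 * size (s d) + 6 * size (s d.+1) + 3)
        (upd (upd s d (s d.+1)) d.+1 [::]).
Proof.
move=> sd2.
have h1 := exec_clear d s.
have h2 := @exec_move_rev d.+1 d.+2 (upd s d [::]) ltac:(lia).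
have h3 := @exec_move_rev d.+2 d _ ltac:(lia).
apply: execb_le (execb_seq h1 (execb_seq h2 (h3 _))) _ _.
- rewrite updE !(updN, updE) ?sd2 ?catrevE ?cats0 ?size_rev; lia.
- by store_eq; rewrite sd2 cats0 revK.
Qed.

(** * Renaming and erasing registers *)

Fixpoint rename (f : nat -> nat) (c : cmd) : cmd :=
  match c with
  | Skip => Skip
  | Push r b => Push (f r) b
  | Seq c1 c2 => Seq (rename f c1) (rename f c2)
  | Pop r c0 cf ct => Pop (f r) (rename f c0) (rename f cf) (rename f ct)
  | While r c => While (f r) (rename f c)
  end.

Definition restore (f : nat -> nat) (S s : store) : Prop :=
  forall r, S (f r) = s r.

Lemma restore_upd f S s r w : injective f -> restore f S s ->
  restore f (upd S (f r) w) (upd s r w).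
Proof. by move=> fI h q; rewrite /upd (inj_eq fI) h. Qed.

(** Injectivity keeps distinct registers of the program distinct. The last clause protects the
    registers outside the image of [f], which will hold a surrounding context. *)
Lemma exec_rename f c s t s' S : injective f -> exec c s t s' ->
  restore f S s ->
  exists S', [/\ exec (rename f c) S t S', restore f S' s'
             & forall q, (forall r, q <> f r) -> S' q = S q].
Proof.
move=> fI ex; elim: ex S => {c s t s'} /=.
- by move=> s S h; exists S; split=> //; exact: exec_skip.
- move=> r b s S h; exists (upd S (f r) (b :: S (f r))); split.
  + exact: exec_push.
  + by rewrite h; apply: restore_upd.
  + by move=> q nq; rewrite updN //; apply/eqP.
- move=> c1 c2 s1 s2 s3 t1 t2 _ IH1 _ IH2 S /IH1[S1 [e1 r1 n1]].
  have [S2 [e2 r2 n2]] := IH2 _ r1.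
  exists S2; split=> //; first exact: exec_seq e1 e2.
  by move=> q nq; rewrite n2 ?n1.
- move=> r c0 cf ct s t s' sr _ IH S h; have [S' [e1 r1 n1]] := IH _ h.
  by exists S'; split=> //; apply: exec_pop_nil => //; rewrite h.
- move=> r c0 cf ct s b w t s' sr _ IH S h.
  have [S' [e1 r1 n1]] := IH _ (restore_upd r w fI h).
  exists S'; split=> //.
    by apply: (@exec_pop_cons _ _ _ _ _ b w); [rewrite h | case: b {sr IH} e1].
  by move=> q nq; rewrite n1 // updN //; apply/eqP.
- move=> r c s sr S h; exists S; split=> //.
  by apply: exec_while_nil; rewrite h.
- move=> r c s1 s2 s3 t1 t2 sr _ IH1 _ IH2 S h.
  have [S1 [e1 r1 n1]] := IH1 _ h; have [S2 [e2 r2 n2]] := IH2 _ r1.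
  exists S2; split=> //; last by move=> q nq; rewrite n2 ?n1.
  by apply: exec_while_cons e1 e2; rewrite h.
Qed.

Fixpoint width (c : cmd) : nat :=
  match c with
  | Skip => 0
  | Push r b => r.+1
  | Seq c1 c2 => maxn (width c1) (width c2)
  | Pop r c0 cf ct => maxn r.+1 (maxn (width c0) (maxn (width cf) (width ct)))
  | While r c => maxn r.+1 (width c)
  end.

(** Only finitely many registers can be dirtied by a given program, so a fixed program can clean up
    after it. *)
Lemma exec_width c s t s' q : exec c s t s' -> width c <= q -> s' q = s q.
Proof.
move=> ex; elim: ex => {c s t s'} //=.
- by move=> r b s h; rewrite updN //; lia.
- by move=> c1 c2 s1 s2 s3 t1 t2 _ IH1 _ IH2 h; rewrite IH2 ?IH1 //; lia.
- by move=> r c0 cf ct s t s' _ _ IH h; apply: IH; lia.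
- move=> r c0 cf ct s b w t s' _ _ IH h; rewrite IH.
    by rewrite updN //; lia.
  by case: b {IH}; lia.
- by move=> r c s1 s2 s3 t1 t2 _ _ IH1 _ IH2 h; rewrite IH2 ?IH1 //; lia.
Qed.

Fixpoint clear_from (d k : nat) : cmd :=
  if k is k'.+1 then Seq (clear d) (clear_from d.+1 k') else Skip.

Lemma exec_clear_from d k s b : (forall r, size (s r) <= b) ->
  execb (clear_from d k) s (k * (3 * b + 1) + 1)
    (fun r => if d <= r < d + k then [::] else s r).
Proof.
elim: k d s => [|k IH] d s sb /=.
  apply: execb_le (execb_exec (exec_skip s)) _ _; first lia.
  by apply: funext => r; case: ifP => //; lia.
have h1 := exec_clear d s.
have sb' r : size (upd s d [::] r) <= b by rewrite /upd; case: eqP.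
apply: execb_le (execb_seq h1 (IH _ _ sb')) _ _.
  by have := sb d; lia.
apply: funext => r; rewrite /upd.
by case: eqP => [->|nr]; do 2 case: ifP => //; lia.
Qed.

(** * Typed contexts and polynomial bounds *)

Class code (T : Type) := enc : T -> bits.
#[export] Instance code_bits : code bits := id.
#[export] Instance code_bool : code bool := fun b => [:: b].
(** Unary, so that a number can drive a loop; binary numbers are handled as [bits]. *)
#[export] Instance code_nat : code nat := fun n => nseq n true.

Class ctx (G : Type) := Ctx {
  arity : nat;
  regs : G -> seq bits;
  size_regs : forall g, size (regs g) = arity }.
Arguments arity G {ctx}.

#[export] Instance ctx_unit : ctx unit :=
  @Ctx unit 0 (fun _ => [::]) (fun _ => erefl).

Lemma size_rcons_regs G {cG : ctx G} A {cA : code A} (p : G * A) :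
  size (rcons (regs p.1) (enc p.2)) = (arity G).+1.
Proof. by rewrite size_rcons size_regs. Qed.

#[export] Instance ctx_pair G {cG : ctx G} A {cA : code A} : ctx (G * A) :=
  Ctx (@size_rcons_regs G cG A cA).

Definition store_of G {cG : ctx G} (g : G) : store := nth [::] (regs g).
Definition load G {cG : ctx G} (g : G) : nat := sumn (map size (regs g)).

Lemma store_of_pair G {cG : ctx G} A {cA : code A} (g : G) (a : A) :
  store_of (g, a) = upd (store_of g) (arity G) (enc a).
Proof.
apply: funext => q; rewrite /store_of /upd /= nth_rcons size_regs.
case: ltngtP => // h; by rewrite nth_default ?size_regs // ltnW.
Qed.

Lemma store_of_last G {cG : ctx G} A {cA : code A} (g : G) (a : A) :
  store_of (g, a) (arity G) = enc a.
Proof. by rewrite store_of_pair updE. Qed.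

Lemma store_of_out G {cG : ctx G} (g : G) q : arity G <= q -> store_of g q = [::].
Proof. by move=> h; rewrite /store_of nth_default ?size_regs. Qed.

Lemma load_pair G {cG : ctx G} A {cA : code A} (g : G) (a : A) :
  load (g, a) = load g + size (enc a).
Proof. by rewrite /load /= map_rcons sumn_rcons. Qed.

(** The base is at least 2, so constants and sums are absorbed by raising the exponent, and a single
    parameter suffices. *)
Definition poly G {cG : ctx G} (b : G -> nat) : Prop :=
  exists k, forall g, b g <= (load g + 2) ^ k.

Section Poly.
Variables (G : Type) (cG : ctx G).
Implicit Types b : G -> nat.

Lemma poly_le b b' : (forall g, b g <= b' g) -> poly b' -> poly b.
Proof. by move=> h [k kP]; exists k => g; apply: leq_trans (h g) (kP g). Qed.

Lemma poly_const n : poly (fun _ : G => n).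
Proof. by exists n => g; apply/ltnW/ltn_expl; lia. Qed.

Lemma poly_load : poly (fun g : G => load g).
Proof. by exists 1 => g; rewrite expn1; lia. Qed.

Lemma poly_add b1 b2 : poly b1 -> poly b2 -> poly (fun g => b1 g + b2 g).
Proof.
move=> [k1 h1] [k2 h2]; exists (k1 + k2).+1 => g.
have [X0 X1] : 0 < load g + 2 /\ 1 < load g + 2 by lia.
have l1 := leq_trans (h1 g) (leq_pexp2l X0 (leq_addr k2 k1)).
have l2 := leq_trans (h2 g) (leq_pexp2l X0 (leq_addl k1 k2)).
by rewrite expnS; nia.
Qed.

Lemma poly_mul b1 b2 : poly b1 -> poly b2 -> poly (fun g => b1 g * b2 g).
Proof.
by move=> [k1 h1] [k2 h2]; exists (k1 + k2) => g; rewrite expnD leq_mul.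
Qed.

Lemma poly_comp G' (cG' : ctx G') (phi : G' -> G) b :
  poly (fun g => load (phi g)) -> poly b -> poly (fun g => b (phi g)).
Proof.
move=> [k1 h1] [k2 h2]; exists (k1.+2 * k2) => g.
apply: leq_trans (h2 _) _; rewrite expnM; case: k2 {h2} => // k2.
rewrite leq_exp2r //; have := h1 g; have := expn_gt0 (load g + 2) k1.
rewrite !expnS; nia.
Qed.

End Poly.

(** Equality of the whole final store means that the inputs survive and that every scratch register
    is left empty; this is what makes programs composable. *)
Definition PT G {cG : ctx G} T {cT : code T} (f : G -> T) : Prop :=
  exists c (b : G -> nat), poly b /\
    forall g, execb c (store_of g) (b g) (store_of (g, f g)).

Lemma PT_ext G {cG : ctx G} T {cT : code T} (f f' : G -> T) :
  f =1 f' -> PT f -> PT f'.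
Proof.
by move=> ff' [c [b [pb h]]]; exists c, b; split=> // g; rewrite -ff'.
Qed.

Lemma PT_size G {cG : ctx G} T {cT : code T} (f : G -> T) :
  PT f -> poly (fun g => size (enc (f g))).
Proof.
move=> [c [b [pb h]]]; apply: poly_le pb => g.
have [t tb /exec_size] := h g; move=> /(_ (arity G)).
by rewrite store_of_pair updE store_of_out //; move=> h1; apply: leq_trans h1 tb.
Qed.

Section Closure.
Variables (G : Type) (cG : ctx G).
Local Notation m := (@arity G cG).

Lemma PT_weak A {cA : code A} T {cT : code T} (f : G -> T) :
  PT f -> PT (fun p : G * A => f p.1).
Proof.
case=> c [b [pb h]].
(* The renaming skips register [m], which holds the extra variable; the value, formerly in [m],
   lands in [m.+1]. *)
pose rho r := if r < m then r else r.+1.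
have rhoI : injective rho.
  move=> x y; rewrite /rho.
  by have [hx|hx] := ltnP x m; have [hy|hy] := ltnP y m; lia.
exists (rename rho c), (fun p => b p.1); split.
  apply: poly_comp pb; apply: poly_le (poly_load _) => -[g a].
  by rewrite load_pair leq_addr.
case=> g a; have [t tb ex] := h g.
have rS : restore rho (store_of (g, a)) (store_of g).
  move=> r; rewrite store_of_pair /rho; have [rm|rm] := ltnP r m.
    by rewrite updN //; lia.
  by rewrite updN ?store_of_out //; lia.
have [S' [ex' r1 n1]] := exec_rename rhoI ex rS.
exists t => //; have SE : S' = store_of (g, a, f g); last by rewrite -SE.
apply: funext => q; rewrite store_of_pair /=.
have [qm|] := ltnP q m.
  have := r1 q; rewrite /rho qm => ->.
  by rewrite !store_of_pair !updN //=; lia.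
rewrite leq_eqVlt => /orP[/eqP <-|mq].
  rewrite n1 ?store_of_pair ?updE ?[upd _ m.+1 _ _]updN ?updE //; first lia.
  by move=> r; rewrite /rho; have [|] := ltnP r m; lia.
have := r1 q.-1; rewrite /rho ltnNge; have -> : m <= q.-1 by lia.
rewrite /= prednK; last lia.
move=> ->; rewrite !store_of_pair /=; have [->|qm] := eqVneq q m.+1.
  by rewrite !updE.
by rewrite !updN ?store_of_out //=; lia.
Qed.

Lemma PT_last A {cA : code A} : PT (fun p : G * A => p.2).
Proof.
exists (copy m m.+1), (fun p => 7 * load p + 2); split.
  by apply: poly_add (poly_const _ _); apply: poly_mul (poly_const _ _) (poly_load _).
case=> g a; apply: execb_le (exec_copy _ _ _) _ _.
- lia.
- by rewrite store_of_out.
- by rewrite store_of_out.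
- by rewrite load_pair store_of_pair updE; lia.
- by rewrite [RHS]store_of_pair [in X in _ = X]/= store_of_pair updE.
Qed.

End Closure.

Section Composition.
Variables (G : Type) (cG : ctx G).
Local Notation m := (@arity G cG).

Lemma PT_if T {cT : code T} (b : G -> bool) (f1 f2 : G -> T) :
  PT b -> PT f1 -> PT f2 -> PT (fun g => if b g then f1 g else f2 g).
Proof.
move=> [c0 [b0 [pb0 h0]]] [c1 [b1 [pb1 h1]]] [c2 [b2 [pb2 h2]]].
exists (Seq c0 (Pop m Skip c2 c1)), (fun g => b0 g + (b1 g + b2 g + 1)); split.
  by apply: poly_add pb0 (poly_add (poly_add pb1 pb2) (poly_const _ _)).
move=> g; apply: execb_seq (h0 g) _.
have h : execb (if b g then c1 else c2) (store_of g) (b1 g + b2 g)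
    (store_of (g, if b g then f1 g else f2 g)).
  case: (b g).
    by apply: execb_le (h1 g) (leq_addr _ _) erefl.
  by apply: execb_le (h2 g) (leq_addl _ _) erefl.
(* [Pop] consumes the test bit, so each branch starts again from the store of [g]. *)
rewrite addn1; apply: (@execb_pop_cons _ _ _ _ _ (b g) [::]).
  by rewrite store_of_pair updE.
by rewrite store_of_pair upd_upd (upd_id (store_of_out _ (leqnn _))).
Qed.

Lemma PT_const T {cT : code T} (v : T) : PT (fun _ : G => v).
Proof.
exists (foldr (fun b c => Seq c (Push m b)) Skip (enc v)),
  (fun _ => 2 * size (enc v) + 1); split; first exact: poly_const.
move=> g; rewrite store_of_pair; elim: (enc v) => [|b w IH] /=.
  apply: execb_le (execb_exec (exec_skip _)) _ _; first lia.
  by rewrite upd_id ?store_of_out.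
apply: execb_le (execb_seq IH (execb_push _ _ _)) _ _; first lia.
by rewrite updE upd_upd.
Qed.

(** For operations performed in place on the last register, in time linear in its size. *)
Lemma PT_post A {cA : code A} T {cT : code T} (op : A -> T) (q : cmd) k :
  (forall (g : G) a, execb q (store_of (g, a)) (k * (size (enc a) + 1))
     (store_of (g, op a))) ->
  forall a : G -> A, PT a -> PT (fun g => op (a g)).
Proof.
move=> hq a pa; have ps := PT_size pa; case: pa => c [b [pb h]].
exists (Seq c q), (fun g => b g + (k * (size (enc (a g)) + 1))); split.
  apply: (poly_add pb); apply: poly_mul; first exact: poly_const.
  by apply: poly_add ps (poly_const _ _).
by move=> g; apply: execb_seq (h g) (hq _ _).
Qed.

Lemma PT_behead (w : G -> bits) : PT w -> PT (fun g => behead (w g)).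
Proof.
apply: (@PT_post bits _ bits _ behead (Pop m Skip Skip Skip) 2) => g a.
case: a => [|x a] /=.
  apply: execb_le (execb_pop_nil _ _ (store_of_last g _) (execb_exec (exec_skip _))) _ erefl.
  by [].
apply: execb_le (execb_pop_cons _ (store_of_last g (x :: a)) _) _ erefl.
- rewrite !store_of_pair upd_upd.
  case: x; exact/execb_exec/exec_skip.
- by rewrite /enc /=; lia.
Qed.

Lemma PT_head (w : G -> bits) : PT w -> PT (fun g => head false (w g)).
Proof.
pose q := Pop m (Push m false) (Seq (clear m) (Push m false))
  (Seq (clear m) (Push m true)).
apply: (@PT_post bits _ bool _ _ q 5) => g a.
case: a => [|x a] /=.
  apply: execb_le (execb_pop_nil _ _ (store_of_last g _) (execb_push _ _ _)) _ _.
  - by [].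
  - by rewrite !store_of_pair updE upd_upd.
apply: execb_le (execb_pop_cons _ (store_of_last g (x :: a)) _) _ erefl.
- rewrite !store_of_pair upd_upd.
  have := execb_seq (exec_clear m _) (execb_push m x _).
  move=> /(_ (upd (store_of g) m a)); rewrite !upd_upd !updE.
  by case: x; apply.
- by rewrite /enc /=; lia.
Qed.

Lemma PT_nilp (w : G -> bits) : PT w -> PT (fun g => nilp (w g)).
Proof.
pose q1 := Seq (clear m) (Push m false).
apply: (@PT_post bits _ bool _ _ (Pop m (Push m true) q1 q1) 5) => g a.
case: a => [|x a] /=.
  apply: execb_le (execb_pop_nil _ _ (store_of_last g _) (execb_push _ _ _)) _ _.
  - by [].
  - by rewrite !store_of_pair updE upd_upd.
apply: execb_le (execb_pop_cons _ (store_of_last g (x :: a)) _) _ erefl.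
- rewrite !store_of_pair upd_upd.
  have := execb_seq (exec_clear m _) (execb_push m false _).
  by move=> /(_ (upd (store_of g) m a)); rewrite !upd_upd !updE; case: x; apply.
- by rewrite /enc /=; lia.
Qed.

Lemma PT_cons1 b (w : G -> bits) : PT w -> PT (fun g => b :: w g).
Proof.
apply: (@PT_post bits _ bits _ _ (Push m b) 1) => g a.
apply: execb_le (execb_push _ _ _) _ _; first lia.
by rewrite !store_of_pair updE upd_upd.
Qed.

(** Both values have the same code, so the program is unchanged and only its type is read
    differently. *)
Lemma PT_ones (n : G -> nat) : PT n -> PT (fun g => nseq (n g) true).
Proof.
by move=> [c [b [pb h]]]; exists c, b; split=> // g; have := h g;
  rewrite !store_of_pair.
Qed.

Lemma PT_succ (n : G -> nat) : PT n -> PT (fun g => (n g).+1).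
Proof.
apply: (@PT_post nat _ nat _ _ (Push m true) 1) => g a.
apply: execb_le (execb_push _ _ _) _ _; first lia.
by rewrite !store_of_pair updE upd_upd.
Qed.

Lemma PT_pred (n : G -> nat) : PT n -> PT (fun g => (n g).-1).
Proof.
move=> /PT_ones/PT_behead [c [b [pb h]]]; exists c, b; split=> // g.
by have := h g; rewrite !store_of_pair; case: (n g).
Qed.

Lemma PT_size_bits (w : G -> bits) : PT w -> PT (fun g => size (w g)).
Proof.
pose q := While m (Pop m Skip (Push m.+1 true) (Push m.+1 true)).
apply: (@PT_post bits _ nat _ _ (Seq q (slide m)) 12) => g a.
have hq k : execb q (upd (upd (store_of g) m a) m.+1 (nseq k true))
   (3 * size a).+1 (upd (upd (store_of g) m [::]) m.+1 (nseq (k + size a) true)).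
  elim: a k => [|x a IH] k.
    apply: execb_le (execb_while_nil _ _) _ _ => //.
      by rewrite updN ?updE //; lia.
    by rewrite addn0.
  have := IH k.+1; rewrite addSnnS => {}IH.
  apply: execb_le (execb_while_cons _ _ IH) _ erefl.
  - by rewrite updN ?updE //; lia.
  - apply: (@execb_pop_cons _ _ _ _ _ x a).
      by rewrite updN ?updE //; lia.
    have h := execb_push m.+1 true
      (upd (upd (@store_of G cG g) m a) m.+1 (nseq k true)).
    rewrite updE upd_upd in h.
    have -> v : upd (upd (upd (@store_of G cG g) m (x :: a)) m.+1 v) m a =
      upd (upd (@store_of G cG g) m a) m.+1 v by store_eq.
    by case: x; exact: h.
  - by rewrite /=; lia.
have h := hq 0; rewrite upd_id in h; last first.
  by rewrite updN ?store_of_out //; lia.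
rewrite store_of_pair.
apply: execb_le (execb_seq h (exec_slide _)) _ _.
- by rewrite !updN ?store_of_out //; lia.
- rewrite updE updN ?updE; last lia.
  by rewrite size_nseq /enc /code_bits /=; lia.
- by rewrite updE store_of_pair; store_eq; rewrite store_of_out.
Qed.

End Composition.
Arguments PT_last {G cG A cA}.
Arguments PT_const {G cG T cT} v.

(* The index decreases from [n - 1] to [0]. *)
Fixpoint loop A (F : nat -> A -> A) (n : nat) (a : A) : A :=
  if n is i.+1 then loop F i (F i a) else a.

Lemma loop_inv A (F : nat -> A -> A) (P : nat -> A -> Prop) n a :
  P n a -> (forall i b, i < n -> P i.+1 b -> P i (F i b)) -> P 0 (loop F n a).
Proof.
elim: n a => [|n IH] a Pa PF //=; apply: IH; first exact: PF.
by move=> i b i_n; apply: PF; rewrite ltnS ltnW.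
Qed.

Section Loop.
Variables (G : Type) (cG : ctx G) (A : Type) (cA : code A).
Local Notation m := (@arity G cG).

(** Iterating a polynomial-time body may let the accumulator grow exponentially. The invariant [P]
    serves to bound its size along the actual run by the polynomial [B]. *)
Lemma PT_loop (n : G -> nat) (a : G -> A) (F : G -> nat -> A -> A)
    (P : G -> nat -> A -> Prop) (B : G -> nat) :
  PT n -> PT a -> PT (fun p : G * nat * A => F p.1.1 p.1.2 p.2) ->
  (forall g, P g (n g) (a g)) ->
  (forall g i b, i < n g -> P g i.+1 b -> P g i (F g i b)) ->
  (forall g i b, i <= n g -> P g i b -> size (enc b) <= B g) ->
  poly B ->
  PT (fun g => loop (F g) (n g) (a g)).
Proof.
move=> pn pa [cF [bF [pbF hF]]] P0 PS PB pB; have pln := PT_size pn.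
have {pa} [ca [ba [pba ha]]] := @PT_weak G cG nat _ _ _ _ pa.
case: pn => cn [bn [pbn hn]].
have [k kP] := pbF.
pose body := Seq cF (slide m.+1).
(* The power bounds one run of [cF] on a context of size at most [load g + n g + B g]; the rest is
   the [slide], which handles two words of size at most [B g]. *)
pose cost g := (@load G cG g + n g + B g + 2) ^ k + 9 * B g + 3.
exists (Seq cn (Seq ca (Seq (While m (Pop m Skip body body)) (slide m)))),
  (fun g => bn g + (ba (g, n g) + ((n g) * (cost g + 2) + 1 + (6 * B g + 3)))).
have pln' : poly n by apply: poly_le pln => g; rewrite size_nseq.
split.
  apply: (poly_add pbn); apply: poly_add.
    apply: poly_comp pba; apply: poly_le (poly_add (poly_load _) pln) => g.
    by rewrite load_pair.
  have pc : poly cost.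
    apply: poly_add (poly_const _ _); apply: poly_add; last first.
      by apply: poly_mul (poly_const _ _) pB.
    have [k' k'P] : poly (fun g => load g + n g + B g + 2).
      apply: poly_add (poly_const _ _); apply: poly_add pB.
      by apply: poly_add pln'; exact: poly_load.
    exists (k' * k) => g; rewrite expnM.
    by case: (k) => // k0; rewrite leq_exp2r.
  apply: poly_add; last first.
    by apply: poly_add (poly_const _ _); apply: poly_mul (poly_const _ _) pB.
  apply: poly_add (poly_const _ _); apply: (poly_mul pln').
  by apply: poly_add pc (poly_const _ _).
move=> g; apply: execb_seq (hn g) _; apply: execb_seq (ha _) _ => /=.
have hw i b : i <= n g -> P g i b ->
  execb (While m (Pop m Skip body body))
    (upd (upd (store_of g) m (nseq i true)) m.+1 (enc b))
    (i * (cost g + 2) + 1)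
    (upd (upd (store_of g) m [::]) m.+1 (enc (loop (F g) i b))).
  elim: i b => [|i IH] b i_n Pb.
    apply: execb_while_nil; rewrite updN ?updE //; lia.
  have Pb' := PS _ _ _ i_n Pb.
  have hb : execb body (upd (upd (store_of g) m (nseq i true)) m.+1 (enc b))
     (cost g) (upd (upd (store_of g) m (nseq i true)) m.+1 (enc (F g i b))).
    have := hF (g, i, b); rewrite !store_of_pair /= => h.
    apply: execb_le (execb_seq h (exec_slide _)) _ _.
    - by rewrite !updN ?store_of_out //; lia.
    - rewrite updE updN ?updE; last lia.
      have lb := PB _ _ _ i_n Pb; have lb' := PB _ _ _ (ltnW i_n) Pb'.
      have tl : load (g, i, b) <= load g + n g + B g.
        rewrite !load_pair /= size_nseq; lia.
      have := kP (g, i, b) => lk.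
      have l2 : (load (g, i, b) + 2) ^ k <= (load g + n g + B g + 2) ^ k.
        by case: (k) => // k0; rewrite leq_exp2r //; lia.
      rewrite /cost; lia.
    - by rewrite updE -[nseq i true]/(enc i); store_eq; rewrite store_of_out //; lia.
  apply: execb_le (execb_while_cons _ _ (IH _ (ltnW i_n) Pb')) _ erefl.
  - by rewrite updN ?updE //; lia.
  - apply: (@execb_pop_cons _ _ _ _ _ true (nseq i true)).
      by rewrite updN ?updE //; lia.
    rewrite (_ : upd _ m _ = upd (upd (store_of g) m (nseq i true)) m.+1 (enc b)).
      exact: hb.
    by store_eq.
  - lia.
have /= := hw _ _ (leqnn _) (P0 g); rewrite !store_of_pair /= => h.
apply: execb_seq h _.
apply: execb_le (exec_slide _) _ _.
- by rewrite !updN ?store_of_out //; lia.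
- rewrite updE updN ?updE; last lia.
  have Pl : P g 0 (loop (F g) (n g) (a g)).
    by apply: loop_inv (P0 g) _ => i b; exact: PS.
  have := PB _ _ _ (leq0n _) Pl; rewrite (_ : size [::] = 0) //; lia.
- by rewrite updE; store_eq; rewrite store_of_out.
Qed.

End Loop.

Lemma poly_bound_poly G {cG : ctx G} k (b : G -> nat) :
  poly b -> poly (fun g => poly_bound k (b g)).
Proof.
move=> [d dP]; apply: poly_add (poly_const _ _); apply: (poly_mul (poly_const _ _)).
exists (d * k) => g; rewrite expnM.
by case: (k) => // k0; rewrite leq_exp2r.
Qed.

(** This lets a hypothetical solver enter a program. It runs on registers shifted past the context,
    with its input in register [m], and may leave garbage above. Only [width c] registers can be
    dirty, and each holds at most the bits present at the start plus one per step, so clearing them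
    takes polynomial time. *)
Lemma PT_runs G {cG : ctx G} (h f : G -> bits) c k :
  PT h -> (forall g, runs c k (h g) (f g)) -> PT f.
Proof.
move=> ph fP; have psz := PT_size ph; case: ph => ch [bh [pbh hh]].
pose m := @arity G cG; pose w := width c.
pose T g := poly_bound k (size (h g)).
pose S g := size (h g) + T g + @load G cG g.
exists (Seq ch (Seq (rename (addn m) c) (clear_from m.+1 w))),
  (fun g => bh g + (T g + (w * (3 * S g + 1) + 1))); split.
  apply: (poly_add pbh); apply: poly_add; first exact: poly_bound_poly psz.
  apply: poly_add (poly_const _ _); apply: (poly_mul (poly_const _ _)).
  apply: poly_add (poly_const _ _); apply: (poly_mul (poly_const _ _)).
  by apply: poly_add (poly_load _); apply: (poly_add psz (poly_bound_poly k psz)).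
move=> g; have [t [s [ex tT s0]]] := fP g.
apply: execb_seq (hh g) _.
have rhoI : injective (addn m) by move=> x y; lia.
have rS : restore (addn m) (store_of (g, h g)) (init (h g)).
  move=> r; rewrite store_of_pair /init /upd -[X in _ == X]addn0 eqn_add2l.
  by case: eqP => // _; rewrite store_of_out // leq_addr.
have [S' [ex' r1 n1]] := exec_rename rhoI ex rS.
apply: execb_seq; first by exists t => //; exact: ex'.
have hS r : size (S' r) <= S g.
  have := exec_size r ex'; rewrite store_of_pair /upd.
  case: eqP => _ hr; apply: leq_trans hr _; rewrite /S /T /enc /code_bits.
    lia.
  have : size (store_of g r) <= load g.
    rewrite /store_of /load.
    elim: (regs g) r => [|x l IH] [|r] //=; first lia.
    by apply: leq_trans (IH r) _; lia.
  lia.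
apply: execb_le (exec_clear_from _ _ hS) (leqnn _) _.
apply: funext => q; rewrite store_of_pair.
have [qm|] := ltnP q m.
  rewrite n1; last by move=> r; lia.
  rewrite store_of_pair !updN //; first by case: ifP => //; lia.
  - by rewrite -/m; lia.
  - by rewrite -/m; lia.
rewrite leq_eqVlt => /orP[/eqP <-|mq].
  have := r1 0; rewrite addn0 s0 => ->; rewrite updE.
  by case: ifP => //; lia.
rewrite updN; last by rewrite -/m; lia.
rewrite store_of_out; last by rewrite -/m; lia.
case: ifP => // /negbT; rewrite mq /= -leqNgt => qw.
have -> : q = m + (q - m) by lia.
rewrite r1 (exec_width ex); last by rewrite -/w; lia.
by rewrite /init; case: eqP => //; lia.
Qed.

Lemma PT_polytime (f : bits -> bits) :
  PT (fun p : unit * bits => f p.2) -> polytime f.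
Proof.
move=> pf; have [k kP] := PT_size pf; case: pf => c [b [[k' k'P] h]].
pose c' := Seq c (slide 0).
have [K KP] : exists K, forall n, (n + 2) ^ k' + (3 * n + 6 * (n + 2) ^ k + 3)
    <= poly_bound K n.
  have [K KP] : poly (fun p : unit * bits => (size p.2 + 2) ^ k' +
      (3 * size p.2 + 6 * (size p.2 + 2) ^ k + 3)).
    have pp k1 : poly (fun p : unit * bits => (size p.2 + 2) ^ k1).
      by exists k1 => -[[] x]; rewrite load_pair.
    apply: (poly_add (pp _)); apply: poly_add (poly_const _ _).
    apply: poly_add; apply: (poly_mul (poly_const _ _)); last exact: pp.
    by have := pp 1; apply: poly_le => p; rewrite expn1; lia.
  (* For positive [n], [(n + 2) ^ K] is at most [3 ^ K * n ^ K], and [K < 3 ^ K] allows the larger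
     exponent; the additive constant of [poly_bound] covers [n = 0]. *)
  exists (3 ^ K) => n; have := KP (tt, nseq n true).
  rewrite /= load_pair size_nseq => /leq_trans; apply.
  rewrite (_ : load tt = 0) // add0n.
  rewrite /poly_bound.
  have K3 : K < 3 ^ K by apply: ltn_expl.
  case: n => [|n].
    have l : 2 ^ K <= 3 ^ K by case: (K) => // K'; rewrite leq_exp2r.
    by apply: leq_trans l _; exact: leq_addl.
  apply: leq_trans (leq_addr _ _).
  have l1 : (n.+1 + 2) ^ K <= (3 * n.+1) ^ K.
    by case: (K) => // K'; rewrite leq_exp2r //; lia.
  apply: leq_trans l1 _; rewrite expnMn leq_mul2l; apply/orP; right.
  by apply: leq_pexp2l => //; exact: ltnW.
exists c', K => x; have := h (tt, x); have := kP (tt, x); have := k'P (tt, x).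
have -> : load (tt, x) = size x by rewrite load_pair.
rewrite !store_of_pair /= => b1 b2 ex.
have sE : upd (store_of tt) 0 (enc x) = init x.
  apply: funext => q; rewrite /upd /init; case: eqP => // _.
  by rewrite store_of_out.
rewrite sE in ex.
have [|t tb ex'] := execb_seq ex (@exec_slide 0 _ _).
  by rewrite !updN.
exists t; eexists; split; first exact: ex'.
  apply: leq_trans (KP _); apply: leq_trans tb _.
  rewrite updE updN // /init /=; apply: leq_add => //.
  by rewrite leq_add2r leq_add2l leq_mul2l.
by rewrite updN // updE updE.
Qed.

(** * Polynomial-time functions *)

Lemma loop_cat (T : Type) (f : nat -> seq T) n a :
  loop (fun i acc => f i ++ acc) n a = flatten (mkseq f n) ++ a.
Proof.
elim: n a => [|n IH] a //; rewrite mkseqS flatten_rcons -catA; exact: IH.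
Qed.

Lemma PT_prev G {cG : ctx G} A B {cA : code A} {cB : code B} :
  PT (fun p : G * A * B => p.1.2).
Proof. exact: (@PT_weak _ _ _ _ _ _ (fun p => p.2) PT_last). Qed.

Lemma PT_seq1 G {cG : ctx G} (b : G -> bool) : PT b -> PT (fun g => [:: b g]).
Proof.
by move=> [c [B [pB h]]]; exists c, B; split=> // g; have := h g;
  rewrite !store_of_pair.
Qed.

Lemma PT_and G {cG : ctx G} (a b : G -> bool) : PT a -> PT b -> PT (fun g => a g && b g).
Proof. by move=> pa pb; exact: PT_if pa pb (PT_const false). Qed.

Lemma PT_or G {cG : ctx G} (a b : G -> bool) : PT a -> PT b -> PT (fun g => a g || b g).
Proof. by move=> pa pb; exact: PT_if pa (PT_const true) pb. Qed.

Lemma PT_neg G {cG : ctx G} (a : G -> bool) : PT a -> PT (fun g => ~~ a g).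
Proof. by move=> pa; exact: PT_if pa (PT_const false) (PT_const true). Qed.

Lemma PT_xor G {cG : ctx G} (a b : G -> bool) : PT a -> PT b -> PT (fun g => a g (+) b g).
Proof.
move=> pa pb; apply: PT_ext (PT_if pa (PT_neg pb) pb) => g.
by case: (a g); case: (b g).
Qed.

Lemma PT_eqb G {cG : ctx G} (a b : G -> bool) : PT a -> PT b -> PT (fun g => a g == b g).
Proof.
move=> pa pb; apply: PT_ext (PT_neg (PT_xor pa pb)) => g.
by case: (a g); case: (b g).
Qed.

Lemma PT_cons G {cG : ctx G} (b : G -> bool) (w : G -> bits) :
  PT b -> PT w -> PT (fun g => b g :: w g).
Proof.
move=> pb pw; apply: PT_ext (PT_if pb (PT_cons1 true pw) (PT_cons1 false pw)) => g.
by case: (b g).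
Qed.

Lemma PT_add G {cG : ctx G} (a b : G -> nat) : PT a -> PT b -> PT (fun g => a g + b g).
Proof.
move=> pa pb.
apply: (@PT_ext _ _ _ _ (fun g => loop (fun _ c => c.+1) (a g) (b g))) => [g|].
  by elim: (a g) (b g) => //= n IH m; rewrite IH addnS.
apply: (@PT_loop _ _ _ _ a b (fun _ _ c => c.+1)
  (fun g i c => i + c = a g + b g) (fun g => a g + b g)) => //.
- by apply: PT_succ; exact: PT_last.
- by move=> g i c _ <-; rewrite addnS.
- by move=> g i c _ e; rewrite size_nseq -e leq_addl.
- by apply: poly_add; [have := PT_size pa | have := PT_size pb];
    apply: poly_le => g; rewrite size_nseq.
Qed.

Lemma PT_sub G {cG : ctx G} (a b : G -> nat) : PT a -> PT b -> PT (fun g => a g - b g).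
Proof.
move=> pa pb.
apply: (@PT_ext _ _ _ _ (fun g => loop (fun _ c => c.-1) (b g) (a g))) => [g|].
  by elim: (b g) (a g) => [|n IH] m //=; rewrite ?subn0 // IH; lia.
apply: (@PT_loop _ _ _ _ b a (fun _ _ c => c.-1)
  (fun g i c => c <= a g) (fun g => a g)) => //.
- by apply: PT_pred; exact: PT_last.
- by move=> g i c _; lia.
- by move=> g i c _ e; rewrite size_nseq.
- by have := PT_size pa; apply: poly_le => g; rewrite size_nseq.
Qed.

Lemma PT_eq0 G {cG : ctx G} (a : G -> nat) : PT a -> PT (fun g => a g == 0).
Proof.
by move=> /PT_ones/PT_nilp; apply: PT_ext => g; case: (a g).
Qed.

Lemma PT_leq G {cG : ctx G} (a b : G -> nat) : PT a -> PT b -> PT (fun g => a g <= b g).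
Proof. by move=> pa pb; exact: PT_eq0 (PT_sub pa pb). Qed.

Lemma PT_eqn G {cG : ctx G} (a b : G -> nat) : PT a -> PT b -> PT (fun g => a g == b g).
Proof.
move=> pa pb; apply: PT_ext (PT_and (PT_leq pa pb) (PT_leq pb pa)) => g.
by rewrite -eqn_leq.
Qed.

Lemma PT_drop G {cG : ctx G} (a : G -> nat) (w : G -> bits) :
  PT a -> PT w -> PT (fun g => drop (a g) (w g)).
Proof.
move=> pa pw.
apply: (@PT_ext _ _ _ _ (fun g => loop (fun _ c => behead c) (a g) (w g))) => [g|].
  elim: (a g) (w g) => [|n IH] v /=; first by rewrite drop0.
  by rewrite IH; case: v.
apply: (@PT_loop _ _ _ _ a w (fun _ _ c => behead c)
  (fun g i c => size c <= size (w g)) (fun g => size (w g))) => //.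
- by apply: PT_behead; exact: PT_last.
- by move=> g i c _; rewrite size_behead; lia.
- exact: PT_size pw.
Qed.

Lemma PT_nth G {cG : ctx G} (w : G -> bits) (a : G -> nat) :
  PT w -> PT a -> PT (fun g => nth false (w g) (a g)).
Proof.
move=> pw pa; apply: PT_ext (PT_head (PT_drop pa pw)) => g.
by rewrite -nth0 nth_drop addn0.
Qed.


Lemma PT_mul G {cG : ctx G} (a b : G -> nat) : PT a -> PT b -> PT (fun g => a g * b g).
Proof.
move=> pa pb.
apply: (@PT_ext _ _ _ _ (fun g => loop (fun _ c => c + b g) (a g) 0)) => [g|].
  rewrite -[RHS]addn0; elim: (a g) 0 => [|n IH] m //=.
  by rewrite IH mulSn; lia.
apply: (@PT_loop _ _ _ _ a _ (fun g _ c => c + b g)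
  (fun g i c => i * b g + c = a g * b g) (fun g => a g * b g)) => //.
- exact: PT_const.
- by apply: PT_add; [exact: PT_last | exact: PT_weak (PT_weak pb)].
- by move=> g; rewrite addn0.
- by move=> g i c _; rewrite mulSn; lia.
- by move=> g i c _ e; rewrite size_nseq; lia.
- by apply: poly_mul; [have := PT_size pa | have := PT_size pb];
    apply: poly_le => g; rewrite size_nseq.
Qed.

Lemma PT_odd G {cG : ctx G} (a : G -> nat) : PT a -> PT (fun g => odd (a g)).
Proof.
move=> pa.
apply: (@PT_ext _ _ _ _ (fun g => loop (fun _ c => ~~ c) (a g) false)) => [g|].
  rewrite -[RHS]addbF; elim: (a g) false => [|n IH] m //=.
  by rewrite IH; case: m; case: (odd n).
apply: (@PT_loop _ _ _ _ a _ (fun g _ c => ~~ c)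
  (fun g i c => True) (fun g => 1)) => //.
- exact: PT_const.
- by apply: PT_neg; exact: PT_last.
- exact: poly_const.
Qed.

Lemma PT_cat G {cG : ctx G} (v w : G -> bits) : PT v -> PT w -> PT (fun g => v g ++ w g).
Proof.
move=> pv pw.
apply: (@PT_ext _ _ _ _
  (fun g => loop (fun i acc => nth false (v g) i :: acc) (size (v g)) (w g)))
  => [g|].
  rewrite (@loop_cat _ (fun i => [:: nth false (v g) i])) -[in RHS](mkseq_nth false (v g)).
  by rewrite /mkseq (map_comp (fun b => [:: b]) (nth false (v g))) flatten_seq1.
apply: (@PT_loop _ _ _ _ _ w (fun g i acc => nth false (v g) i :: acc)
  (fun g i acc => i + size acc = size (v g) + size (w g))
  (fun g => size (v g) + size (w g))) => //.
- exact: PT_size_bits.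
- apply: PT_cons _ PT_last; apply: PT_nth _ PT_prev.
  exact: PT_weak (PT_weak pv).
- by move=> g i b _ /= <-; rewrite addnS.
- by move=> g i b _ <-; exact: leq_addl.
- by apply: poly_add; exact: PT_size.
Qed.

Lemma PT_flatten G {cG : ctx G} (n : G -> nat) (f : G -> nat -> bits) :
  PT n -> PT (fun p : G * nat => f p.1 p.2) ->
  PT (fun g => flatten (mkseq (f g) (n g))).
Proof.
move=> pn pf.
have pln : poly n by have := PT_size pn; apply: poly_le => g; rewrite size_nseq.
have [k kP] := PT_size pf.
apply: (@PT_ext _ _ _ _ (fun g => loop (fun i acc => f g i ++ acc) (n g) [::]))
    => [g|]; first by rewrite loop_cat cats0.
apply: (@PT_loop _ _ _ _ n _ (fun g i acc => f g i ++ acc)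
  (fun g i acc => size acc <= (n g - i) * (load g + n g + 2) ^ k)
  (fun g => n g * (load g + n g + 2) ^ k)) => //.
- exact: PT_const.
- by apply: PT_cat _ PT_last; exact: PT_weak pf.
- move=> g i b i_n h; rewrite size_cat.
  have -> : n g - i = (n g - i.+1).+1 by lia.
  rewrite mulSn; apply: leq_add h; apply: leq_trans (kP (g, i)) _.
  case: (k) => // k0; rewrite leq_exp2r // load_pair size_nseq; lia.
- move=> g i b _ /leq_trans; apply; rewrite leq_mul2r leq_subr orbT //.
- apply: (poly_mul pln).
  have [k' k'P] : poly (fun g => load g + n g + 2).
    by apply: poly_add (poly_const _ _); exact: poly_add (poly_load _) pln.
  exists (k' * k) => g; rewrite expnM.
  by case: (k) => // k0; rewrite leq_exp2r.
Qed.

(** The accumulator advances until it meets the first index at which [P] fails, and then stays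
    there. *)
Definition search (P : nat -> bool) (n : nat) : nat :=
  loop (fun _ j => if P j then j.+1 else j) n 0.

Lemma searchP (P : nat -> bool) n k :
  (forall j, j < k -> P j) -> ~~ P k -> k <= n -> search P n = k.
Proof.
move=> Pk nPk kn; rewrite /search.
have -> // : loop (fun _ j => if P j then j.+1 else j) n 0 = minn k (n - 0).
  apply: (@loop_inv _ _ (fun i j => j = minn k (n - i))) => [|i b i_n ->]; first lia.
  case: ifP => [h|/negP h].
    have : minn k (n - i.+1) != k by apply: contraNneq nPk => <-.
    lia.
  have : ~ (minn k (n - i.+1) < k) by move=> /Pk.
  lia.
lia.
Qed.

Lemma PT_search G {cG : ctx G} (P : G -> nat -> bool) (n : G -> nat) :
  PT (fun p : G * nat * nat => P p.1.1 p.2) -> PT n ->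
  PT (fun g => search (P g) (n g)).
Proof.
move=> pP pn.
apply: (@PT_loop _ _ _ _ n _ (fun g _ j => if P g j then j.+1 else j)
  (fun g i j => j + i <= n g) (fun g => n g)) => //.
- exact: PT_const.
- exact: PT_if pP (PT_succ PT_last) PT_last.
- by move=> g i j _; case: ifP; lia.
- by move=> g i j _; rewrite size_nseq; lia.
- by have := PT_size pn; apply: poly_le => g; rewrite size_nseq.
Qed.

Definition lead (w : bits) : nat := find negb w.

Lemma PT_lead G {cG : ctx G} (w : G -> bits) : PT w -> PT (fun g => lead (w g)).
Proof.
move=> pw; apply: (@PT_ext _ _ _ _
  (fun g => search (nth false (w g)) (size (w g)))) => [g|].
  apply: searchP; last exact: find_size.
    by move=> j /(before_find false) /negbFE.
  have [h|h] := ltnP (lead (w g)) (size (w g)).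
    by apply: (nth_find false); rewrite has_find.
  by rewrite nth_default.
apply: PT_search (PT_size_bits pw).
by apply: PT_nth PT_last; exact: PT_weak (PT_weak pw).
Qed.

Lemma PT_all G {cG : ctx G} (n : G -> nat) (P : G -> nat -> bool) :
  PT n -> PT (fun p : G * nat => P p.1 p.2) ->
  PT (fun g => all (P g) (iota 0 (n g))).
Proof.
move=> pn pP.
apply: PT_ext (PT_nilp (PT_flatten pn
  (f := fun g i => if P g i then [::] else [:: true]) _)); last first.
  exact: PT_if pP (PT_const [::] : PT (fun _ => [::] : bits))
    (PT_const [:: true] : PT (fun _ => [:: true] : bits)).
move=> g; rewrite /mkseq; elim: (iota 0 (n g)) => //= i l IH.
by case: (P g i).
Qed.

(** Binary successor, least significant digit first: the initial ones become zeros, and the zero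
    that stops them, or the end of the word, becomes a one. *)
Definition incr (w : bits) : bits :=
  nseq (lead w) false ++ true :: drop (lead w).+1 w.

Lemma PT_incr G {cG : ctx G} (w : G -> bits) : PT w -> PT (fun g => incr (w g)).
Proof.
move=> pw; apply: PT_cat; last first.
  by apply: PT_cons1; apply: PT_drop _ (pw); exact: PT_succ (PT_lead pw).
apply: PT_ext (PT_flatten (f := fun _ _ => [:: false]) (PT_lead pw)
  (PT_const _)) => g.
by rewrite /mkseq; elim: (lead (w g)) 0 => //= k IH m; rewrite IH.
Qed.

Lemma incr_true w : incr (true :: w) = false :: incr w.
Proof. by []. Qed.

(** Makes the binary code of a unary number computable by counting up to it. *)
Lemma nat_bitsS n : nat_bits n.+1 = incr (nat_bits n).
Proof.
rewrite /nat_bits.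
have -> : bin_of_nat n.+1 = Npos (if bin_of_nat n is Npos p then Pos.succ p else xH).
  apply: (can_inj nat_of_binK); rewrite bin_of_natK.
  have := bin_of_natK n; case: (bin_of_nat n) => [|p] /= <- //.
  exact/esym/nat_of_succ_pos.
case: (bin_of_nat n) => //= p; elim: p => [p IH|p _|] //=.
  by rewrite IH incr_true.
by rewrite /incr /= drop0.
Qed.

Lemma PT_nat_bits G {cG : ctx G} (n : G -> nat) :
  PT n -> PT (fun g => nat_bits (n g)).
Proof.
move=> pn.
apply: (@PT_ext _ _ _ _ (fun g => loop (fun _ w => incr w) (n g) [::])) => [g|].
  suff h k : loop (fun _ w => incr w) (n g) (nat_bits k) = nat_bits (n g + k).
    by rewrite (h 0) addn0.
  by elim: (n g) k => //= m IH k; rewrite -nat_bitsS IH addnS.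
apply: (@PT_loop _ _ _ _ n _ (fun _ _ w => incr w)
  (fun g i w => size w + i <= n g) (fun g => n g)) => //.
- exact: PT_const.
- exact/PT_incr/PT_last.
- move=> g i w _; rewrite size_cat size_nseq /= size_drop.
  have := find_size negb w; rewrite -/(lead w); lia.
- by move=> g i w _; rewrite /enc /code_bits; lia.
- by have := PT_size pn; apply: poly_le => g; rewrite size_nseq.
Qed.

(** * Arithmetic on binary words *)

Definition bval (w : bits) : nat := foldr (fun (b : bool) n => b + n.*2) 0 w.

Lemma bval_incr w : bval (incr w) = (bval w).+1.
Proof.
elim: w => [|[] w IH] //; first by rewrite incr_true /= IH; lia.
by rewrite /incr /= drop0 add0n.
Qed.

Lemma bval_nat_bits n : bval (nat_bits n) = n.
Proof. by elim: n => // n IH; rewrite nat_bitsS bval_incr IH. Qed.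

Lemma bval_drop w i : bval (drop i w) = nth false w i + (bval (drop i.+1 w)).*2.
Proof.
have [h|h] := ltnP i (size w); first by rewrite (drop_nth false h).
by rewrite !drop_oversize ?nth_default //; exact: leqW.
Qed.

Lemma bval_rcons w b : bval (rcons w b) = bval w + b * 2 ^ size w.
Proof.
elim: w => [|c w IH] /=; first by rewrite expn0 muln1 addn0.
by rewrite IH expnS; lia.
Qed.

(* The accumulator is the carry followed by the digits already computed. *)
Definition badd_step (v w acc : bits) : bits :=
  let c := head false acc in
  let a := nth false v (size (behead acc)) in
  let b := nth false w (size (behead acc)) in
  (if a then b || c else b && c) :: (behead acc ++ [:: a (+) b (+) c]).

Definition badd (v w : bits) : bits :=
  behead (loop (fun _ => badd_step v w) (size v + size w).+1 [:: false]).

Lemma bval_badd v w : bval (badd v w) = bval v + bval w.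
Proof.
rewrite /badd; set n := (size v + size w).+1; set acc := loop _ _ _.
have low u k : bval u = bval (take k u) + bval (drop k u) * 2 ^ k.
  elim: u k => [|b u IH] [|k]; rewrite ?take0 ?drop0 ?muln1 //=.
  by rewrite (IH k) expnS; lia.
have takeS u k : bval (take k.+1 u) = bval (take k u) + nth false u k * 2 ^ k.
  elim: u k => [|b u IH] [|k]; rewrite ?take0 ?drop0 ?muln1 /= ?expn0 //.
    by rewrite take0 /=; lia.
  by rewrite IH expnS; lia.
have [acc0 sz e] : [/\ acc <> [::], size (behead acc) = n - 0 &
    bval (take (n - 0) v) + bval (take (n - 0) w) =
      bval (behead acc) + head false acc * 2 ^ (n - 0)].
  apply: (@loop_inv _ _ (fun i acc => [/\ acc <> [::],
    size (behead acc) = n - i & bval (take (n - i) v) + bval (take (n - i) w) =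
      bval (behead acc) + head false acc * 2 ^ (n - i)])).
    by rewrite subnn !take0.
  move=> i b i_n [b0 sz e].
  have ni : n - i = (n - i.+1).+1 by lia.
  split=> //=; first by rewrite size_cat sz /=; lia.
  rewrite ni !takeS sz cats1 bval_rcons sz expnS.
  move: e; case: (nth false v _); case: (nth false w _); case: (head false b) => /=;
    rewrite ?mul1n ?mul0n; lia.
move: e; rewrite subn0 !take_oversize; try by rewrite /n; lia.
(* No carry can remain: it would make the sum at least [2 ^ n], while both numbers are below
   [2 ^ (n - 1)]. *)
move=> e; rewrite e; case: (head false acc) e => e; last lia.
have lt u : bval u < 2 ^ size u.
  by elim: u => //= b u; rewrite expnS; case: b; lia.
have := lt v; have := lt w.
have l1 : 2 ^ size v <= 2 ^ (size v + size w) by apply: leq_pexp2l; lia.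
have l2 : 2 ^ size w <= 2 ^ (size v + size w) by apply: leq_pexp2l; lia.
by move: e; rewrite mul1n /n expnS; lia.
Qed.

Lemma size_badd v w : size (badd v w) = (size v + size w).+1.
Proof.
rewrite /badd; set n := _.+1; set acc := loop _ _ _.
suff [_ ->] : acc <> [::] /\ size (behead acc) = n - 0 by rewrite subn0.
apply: (@loop_inv _ _ (fun i acc => acc <> [::] /\ size (behead acc) = n - i)).
  by rewrite subnn.
by move=> i b i_n [b0 sz]; split=> //=; rewrite size_cat sz /=; lia.
Qed.

Lemma PT_badd G {cG : ctx G} (v w : G -> bits) :
  PT v -> PT w -> PT (fun g => badd (v g) (w g)).
Proof.
move=> pv pw; apply: PT_behead.
apply: (@PT_loop _ _ _ _ (fun g => (size (v g) + size (w g)).+1) _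
  (fun g _ => badd_step (v g) (w g))
  (fun g i acc => size acc + i <= (size (v g) + size (w g)).+2)
  (fun g => (size (v g) + size (w g)).+2)) => //.
- by apply: PT_succ; apply: PT_add; exact: PT_size_bits.
- exact: PT_const.
- have pc : PT (fun p : G * nat * bits => head false p.2) by exact: PT_head PT_last.
  have pb : PT (fun p : G * nat * bits => behead p.2) by exact: PT_behead PT_last.
  have pn u : PT u -> PT (fun p : G * nat * bits =>
      nth false (u p.1.1) (size (behead p.2))).
    by move=> pu; apply: PT_nth (PT_size_bits pb); exact: PT_weak (PT_weak pu).
  apply: PT_cons.
    by apply: PT_if (pn _ pv) (PT_or (pn _ pw) pc) (PT_and (pn _ pw) pc).
  apply: PT_cat pb _; apply: PT_seq1.
  exact: PT_xor (PT_xor (pn _ pv) (pn _ pw)) pc.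
- by move=> g i b i_n h /=; rewrite size_cat /=; case: b h => //= b l; lia.
- by move=> g i b _; rewrite /enc /code_bits; lia.
- have := poly_add (poly_add (PT_size pv) (PT_size pw)) (poly_const _ 2).
  by apply: poly_le => g; rewrite addn2.
Qed.

(** Horner's rule: [loop] meets the digits of [v] from the most significant one, and the prefixed
    [false] doubles the accumulator. *)
Definition bmul (v w : bits) : bits :=
  loop (fun i acc => badd (false :: acc) (if nth false v i then w else [::]))
    (size v) [::].

Lemma bval_bmul v w : bval (bmul v w) = bval v * bval w.
Proof.
rewrite /bmul -[v in RHS]drop0.
apply: (@loop_inv _ _ (fun i acc => bval acc = bval (drop i v) * bval w)).
  by rewrite drop_size.
move=> i b i_n e; rewrite bval_badd /= e [in RHS]bval_drop.
by case: (nth false v i) => /=; lia.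
Qed.

Lemma PT_bmul G {cG : ctx G} (v w : G -> bits) :
  PT v -> PT w -> PT (fun g => bmul (v g) (w g)).
Proof.
move=> pv pw.
apply: (@PT_loop _ _ _ _ (fun g => size (v g)) _
  (fun g i acc => badd (false :: acc) (if nth false (v g) i then w g else [::]))
  (fun g i acc => size acc <= (size (v g) - i) * (size (w g) + 2))
  (fun g => size (v g) * (size (w g) + 2))) => //.
- exact: PT_size_bits.
- exact: PT_const.
- apply: PT_badd; first exact: PT_cons1 PT_last.
  apply: PT_if (PT_weak (PT_weak pw)) (PT_const _).
  by apply: PT_nth PT_prev; exact: PT_weak (PT_weak pv).
- move=> g i b i_n h; rewrite size_badd /=.
  have -> : size (v g) - i = (size (v g) - i.+1).+1 by lia.
  by case: (nth false (v g) i) => /=; lia.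
- by move=> g i b _ /leq_trans; apply; rewrite leq_mul2r leq_subr orbT.
- apply: poly_mul (PT_size pv) _.
  exact: poly_add (PT_size pw) (poly_const _ 2).
Qed.

(* Digits are compared from the most significant one; the accumulator is empty
   as long as they agree. *)
Definition bleq (v w : bits) : bool :=
  let acc := loop (fun i acc => if nilp acc then
      if nth false v i == nth false w i then [::] else [:: nth false w i]
    else acc) (size v + size w) [::] in
  nilp acc || head false acc.

Lemma bleqE v w : bleq v w = (bval v <= bval w).
Proof.
rewrite /bleq; set acc := loop _ _ _.
pose P i (b : bits) := if b is c :: _ then
    if c then bval (drop i v) < bval (drop i w)
    else bval (drop i w) < bval (drop i v)
  else bval (drop i v) == bval (drop i w).
have : P 0 acc.
  apply: (@loop_inv _ _ P) => [|i [|b l] i_n]; rewrite /P ?(bval_drop _ i) /=.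
  - by rewrite !drop_oversize; lia.
  - by case: (nth false v i); case: (nth false w i) => /=; lia.
  - by case: b; case: (nth false v i); case: (nth false w i) => /=; lia.
rewrite /P !drop0; case: acc => [|[] l] /=; lia.
Qed.

Lemma PT_bleq G {cG : ctx G} (v w : G -> bits) :
  PT v -> PT w -> PT (fun g => bleq (v g) (w g)).
Proof.
move=> pv pw; pose F g i (acc : bits) := if nilp acc then
  if nth false (v g) i == nth false (w g) i then [::]
  else [:: nth false (w g) i] else acc.
suff h : @PT G cG bits code_bits (fun g => loop (F g) (size (v g) + size (w g)) [::]).
  by apply: PT_ext (PT_or (PT_nilp h) (PT_head h)) => g.
apply: (@PT_loop _ _ _ _ (fun g => size (v g) + size (w g)) _ F
  (fun g i acc => size acc <= 1) (fun g => 1)) => //.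
- by apply: PT_add; exact: PT_size_bits.
- exact: PT_const.
- have pn u : PT u -> PT (fun p : G * nat * bits => nth false (u p.1.1) p.1.2).
    by move=> pu; apply: PT_nth PT_prev; exact: PT_weak (PT_weak pu).
  apply: PT_if (PT_nilp PT_last) _ PT_last.
  exact: PT_if (PT_eqb (pn _ pv) (pn _ pw)) (PT_const _) (PT_seq1 (pn _ pw)).
- by move=> g i [|b l] _ h; rewrite /F //=; case: ifP.
- exact: poly_const.
Qed.

(** * Self-delimiting codes *)

Lemma PT_delim G {cG : ctx G} (w : G -> bits) : PT w -> PT (fun g => delim (w g)).
Proof.
move=> pw; apply: PT_cat; last exact: PT_const.
apply: (@PT_ext _ _ _ _ (fun g =>
  flatten (mkseq (fun i => [:: true; nth false (w g) i]) (size (w g))))) => [g|].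
  rewrite -[in RHS](mkseq_nth false (w g)) /mkseq -map_comp //.
apply: PT_flatten; first exact: PT_size_bits.
by apply: PT_cons1; apply: PT_seq1; apply: PT_nth PT_last; exact: PT_weak.
Qed.

(** In [delim w ++ r] the marks at even positions are [true] up to the end of [w], so the first
    [false] among them gives the length of [w]. *)
Definition delim_size (y : bits) : nat :=
  search (fun j => nth false y (j + j)) (size y).
Definition delim_head (y : bits) : bits :=
  mkseq (fun i => nth false y (i + i).+1) (delim_size y).
Definition delim_rest (y : bits) : bits :=
  drop (delim_size y + delim_size y).+1 y.

Lemma delim_cons b w r : delim (b :: w) ++ r = [:: true, b & delim w ++ r].
Proof. by []. Qed.

Lemma delim_sizeE w r : delim_size (delim w ++ r) = size w.
Proof.
apply: searchP.
- elim: w => // b w IH [|j] //; rewrite delim_cons addnS /= => jw.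
  exact: IH.
- by elim: w => // b w IH; rewrite delim_cons /= addnS.
- elim: w => // b w IH; rewrite delim_cons /=; lia.
Qed.

Lemma delim_headE w r : delim_head (delim w ++ r) = w.
Proof.
rewrite /delim_head delim_sizeE; apply: (@eq_from_nth _ false).
  by rewrite size_mkseq.
move=> i; rewrite size_mkseq => iw; rewrite nth_mkseq //.
by elim: w i iw => // b w IH [|i] // iw; rewrite delim_cons addSn addnS /= IH.
Qed.

Lemma delim_restE w r : delim_rest (delim w ++ r) = r.
Proof.
rewrite /delim_rest delim_sizeE.
elim: w => [|b w IH]; first by rewrite /= drop0.
by rewrite delim_cons /= addnS.
Qed.

Lemma PT_delim_size G {cG : ctx G} (y : G -> bits) :
  PT y -> PT (fun g => delim_size (y g)).
Proof.
move=> py; apply: PT_search; last exact: PT_size_bits.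
apply: PT_nth (PT_add PT_last PT_last); exact: PT_weak (PT_weak py).
Qed.

Lemma PT_delim_head G {cG : ctx G} (y : G -> bits) :
  PT y -> PT (fun g => delim_head (y g)).
Proof.
move=> py; apply: (@PT_ext _ _ _ _ (fun g => flatten (mkseq
    (fun i => [:: nth false (y g) (i + i).+1]) (delim_size (y g))))) => [g|].
  by rewrite /delim_head /mkseq; elim: (iota _ _) => //= i l ->.
apply: PT_flatten; first exact: PT_delim_size.
apply: PT_seq1; apply: PT_nth; first exact: PT_weak.
exact: PT_succ (PT_add PT_last PT_last).
Qed.

Lemma PT_delim_rest G {cG : ctx G} (y : G -> bits) :
  PT y -> PT (fun g => delim_rest (y g)).
Proof.
by move=> py; apply: PT_drop _ (py); apply: PT_succ; apply: PT_add;
  exact: PT_delim_size.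
Qed.

(** * Cones of graphs *)

Lemma PT_nat_of_bool G {cG : ctx G} (b : G -> bool) :
  PT b -> PT (fun g => nat_of_bool (b g)).
Proof.
move=> pb; apply: PT_ext (PT_if pb (PT_const 1) (PT_const 0)) => g.
by case: (b g).
Qed.

Lemma PT_sum G {cG : ctx G} (n : G -> nat) (f : G -> nat -> nat) :
  PT n -> PT (fun p : G * nat => f p.1 p.2) ->
  PT (fun g => \sum_(0 <= i < n g) f g i).
Proof.
move=> pn pf; apply: PT_ext (PT_size_bits (PT_flatten pn
  (f := fun g i => nseq (f g i) true) _)); last exact: PT_ones.
move=> g; rewrite /index_iota subn0 /mkseq.
elim: (iota 0 (n g)) => [|i l IH]; first by rewrite big_nil.
by rewrite big_cons /= size_cat size_nseq IH.
Qed.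

Lemma nth_blocks T (x0 : T) (F : nat -> nat -> T) m n i j :
  i < m -> j < n ->
  nth x0 (flatten (mkseq (fun i => mkseq (F i) n) m)) (i * n + j) = F i j.
Proof.
move=> im jn; rewrite /mkseq.
suff h a : nth x0 (flatten [seq [seq F i0 j0 | j0 <- iota 0 n] | i0 <- iota a m])
  (i * n + j) = F (a + i) j by rewrite h.
elim: m i im a => // m IH [|i] im a /=; rewrite nth_cat size_map size_iota.
  by rewrite mul0n add0n addn0 jn (nth_map 0) ?size_iota // nth_iota.
rewrite mulSn -addnA ltnNge leq_addr /= addKn IH // addSnnS //.
Qed.

Lemma allpairs_enum_ord T n (f : 'I_n -> 'I_n -> T) (F : nat -> nat -> T) :
  (forall u v, f u v = F u v) ->
  [seq f u v | u <- enum 'I_n, v <- enum 'I_n] =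
  flatten (mkseq (fun i => mkseq (F i) n) n).
Proof.
move=> fF; rewrite /mkseq -val_enum_ord -map_comp; congr flatten.
by apply: eq_map => u /=; rewrite -map_comp; apply: eq_map => v /=.
Qed.

Section Decoding.
Variable x : bits.

Definition order : nat := lead x.
Definition adj (i j : nat) : bool := nth false x (order.+1 + (i * order + j)).

(** Odd orders are excluded because they admit no fixed-point-free involution and would give a cone
    of even order. Order 0 is excluded because its cone has zero weights; it is decided
    separately. *)
Definition valid : bool :=
  [&& 0 < order, ~~ odd order, size x == order.+1 + order * order
    & all (fun i => ~~ adj i i && all (fun j => adj i j == adj j i) (iota 0 order))
        (iota 0 order)].

Definition graph : rel 'I_order := fun u v => adj u v.

Definition edges : nat := \sum_(0 <= i < order) \sum_(0 <= j < order) adj i j.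

End Decoding.

Lemma flatten_flatten T (s : seq (seq (seq T))) :
  flatten (flatten s) = flatten (map flatten s).
Proof. by elim: s => //= a s IH; rewrite flatten_cat IH. Qed.

Lemma lead_nseq n w : lead (nseq n true ++ false :: w) = n.
Proof. by elim: n => //= n IH; rewrite /lead /= -/(lead _) IH. Qed.

Lemma order_enc n (e : rel 'I_n) : order (enc_graph e) = n.
Proof. exact: lead_nseq. Qed.

Lemma enc_graphE n (e : rel 'I_n) (F : nat -> nat -> bool) :
  (forall u v, e u v = F u v) ->
  enc_graph e = nseq n true ++ false :: flatten (mkseq (fun i => mkseq (F i) n) n).
Proof. by move=> eF; rewrite /enc_graph (allpairs_enum_ord eF). Qed.

Lemma size_blocks T (F : nat -> nat -> T) m n :
  size (flatten (mkseq (fun i => mkseq (F i) n) m)) = m * n.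
Proof.
suff h a : size (flatten [seq mkseq (F i) n | i <- iota a m]) = m * n by exact: h.
by elim: m a => //= m IH a; rewrite size_cat size_mkseq IH.
Qed.

Lemma adj_enc n (e : rel 'I_n) (u v : 'I_n) : adj (enc_graph e) u v = e u v.
Proof.
(* [nth_blocks] speaks of functions on [nat], so [e] is extended by [false] outside its range. *)
pose F i j := if insub i is Some u then if insub j is Some v then e u v else false
  else false.
have eF u' v' : e u' v' = F u' v' by rewrite /F !valK.
rewrite /adj order_enc (enc_graphE eF) nth_cat size_nseq.
rewrite ltnNge (leq_trans (leqnSn n) (leq_addr _ _)) /= addSn subSn ?leq_addr //.
by rewrite addKn /= nth_blocks // -eF.
Qed.

Lemma validP x : reflect
  (exists n (e : rel 'I_n), [/\ 0 < n, ~~ odd n, symmetric e, irreflexive e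
    & x = enc_graph e]) (valid x).
Proof.
apply: (iffP and4P) => [[n0 nodd /eqP sz /allP h]|].
  have irr : irreflexive (@graph x).
    move=> u; apply/negbTE; have /h/andP[] // : (u : nat) \in iota 0 (order x).
    by rewrite mem_iota ltn_ord.
  have sym : symmetric (@graph x).
    move=> u v; have /h/andP[_ /allP h'] : (u : nat) \in iota 0 (order x).
      by rewrite mem_iota ltn_ord.
    by apply/eqP/h'; rewrite mem_iota ltn_ord.
  exists (order x), (@graph x); split=> //.
  rewrite (@enc_graphE _ _ (adj x)) //; set n := order x in n0 nodd sz *.
  apply: (@eq_from_nth _ false).
    by rewrite size_cat size_nseq /= size_blocks addnS -addSn.
  move=> i; rewrite sz => ix; rewrite nth_cat size_nseq.
  have [i_n|n_i] := ltnP i n.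
    by rewrite nth_nseq i_n; exact/negbFE/(before_find false).
  have [->|] := eqVneq i n.
    rewrite subnn /=; apply/negbTE/(nth_find false).
    by rewrite has_find -/(lead x) -/(order x) sz -/n; lia.
  move=> i_n; have -> : i - n = (i - n.+1).+1 by lia.
  rewrite /= {1}(divn_eq (i - n.+1) n) nth_blocks ?ltn_mod // /adj -/n.
    by rewrite -divn_eq; congr nth; lia.
  by rewrite ltn_divLR //; lia.
case=> n [e [n0 nodd sym irr ->]]; rewrite order_enc; split=> //.
  have eF u v : e u v = adj (enc_graph e) u v by rewrite adj_enc.
  by rewrite {1}(enc_graphE eF) size_cat size_nseq /= size_blocks addnS.
apply/allP => i; rewrite mem_iota /= add0n => i_n.
have adjE j (j_n : j < n) : adj (enc_graph e) i j = e (Ordinal i_n) (Ordinal j_n).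
  by rewrite -adj_enc.
rewrite adjE irr; apply/allP => j; rewrite mem_iota /= add0n => j_n.
by rewrite adjE sym -adj_enc.
Qed.

Lemma edges_enc n (e : rel 'I_n) : edges (enc_graph e) = \sum_(u < n) \sum_(v < n) e u v.
Proof.
rewrite /edges order_enc.
rewrite big_mkord; apply: eq_bigr => u _; rewrite big_mkord.
by apply: eq_bigr => v _; rewrite adj_enc.
Qed.

(* Vertex [0] is the apex, and vertex [i.+1] of the cone is vertex [i] of the
   graph. *)
Definition cone_weight (n : nat) (F : nat -> nat -> bool) (i j : nat) : nat :=
  if (i == 0) || (j == 0) then if i == j then 0 else n.+1 * n.+1
  else F i.-1 j.-1.

Definition cone n (e : rel 'I_n) : 'M[nat]_n.+1 :=
  \matrix_(i, j) match unlift ord0 i, unlift ord0 j with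
    | Some u, Some v => nat_of_bool (e u v)
    | None, None => 0
    | _, _ => n.+1 * n.+1
    end.

Lemma coneE n (e : rel 'I_n) (F : nat -> nat -> bool) i j :
  (forall u v, e u v = F u v) -> cone e i j = cone_weight n F i j.
Proof.
move=> eF; rewrite mxE /cone_weight.
case: unliftP => [u ->|->]; case: unliftP => [v ->|->] //=.
by rewrite eF.
Qed.

Definition cone_code (x : bits) : bits :=
  let N := (order x).+1 in
  nseq N true ++ false :: flatten (mkseq (fun i =>
    flatten (mkseq (fun j => enc_nat (cone_weight (order x) (adj x) i j)) N)) N).

Lemma cone_code_enc n (e : rel 'I_n) : cone_code (enc_graph e) = enc_mx (cone e).
Proof.
rewrite /cone_code order_enc /enc_mx; congr (_ ++ _ :: _).
rewrite (@allpairs_enum_ord _ _ _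
  (fun i j => enc_nat (cone_weight n (adj (enc_graph e)) i j))); last first.
  by move=> u v; rewrite (@coneE _ _ (adj (enc_graph e))) // => *; rewrite adj_enc.
by rewrite flatten_flatten /mkseq -map_comp.
Qed.

(* The inequality [a / d * norm2 <= A / N + 1 / (128 N)] with the denominators
   cleared and both sides squared, where [E] is twice the number of edges. *)
Definition test_coef (n E : nat) : nat :=
  (128 * n.+1) * (128 * n.+1) *
  (2 * n * ((n.+1 * n.+1) * (n.+1 * n.+1)) + E).
Definition test_bound (n E : nat) : nat :=
  128 * (4 * (n.+1 * n.+1) * (n * n) - 2 * E) + 1.

(** The norm involves a square root, so the inequality is tested on squares. Squaring would lose the
    sign of a negative approximation, which always lies below the nonnegative threshold and is
    accepted at once. *)
Definition accepts (x y : bits) : bool :=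
  let a := delim_head (behead y) in
  let d := delim_head (delim_rest (behead y)) in
  head false y ||
  bleq (bmul (bmul a a) (nat_bits (test_coef (order x) (edges x))))
    (bmul (bmul d d) (nat_bits (test_bound (order x) (edges x) *
                                test_bound (order x) (edges x)))).

Lemma accepts_frac n (e : rel 'I_n) (a : int) (d : nat) (E := \sum_(u < n) \sum_(v < n) e u v) :
  accepts (enc_graph e) (enc_frac a d) =
  (a < 0)%R || (`|a| ^ 2 * test_coef n E <= d ^ 2 * test_bound n E ^ 2)%N.
Proof.
rewrite /accepts order_enc edges_enc /enc_frac /=.
rewrite /enc_nat delim_headE delim_restE -[delim _]cats0 delim_headE.
by rewrite bleqE !bval_bmul !bval_nat_bits -!mulnn.
Qed.

Lemma PT_order G {cG : ctx G} (x : G -> bits) : PT x -> PT (fun g => order (x g)).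
Proof. exact: PT_lead. Qed.

Lemma PT_adj G {cG : ctx G} (x : G -> bits) (i j : G -> nat) :
  PT x -> PT i -> PT j -> PT (fun g => adj (x g) (i g) (j g)).
Proof.
move=> px pi pj; have po := PT_order px.
by apply: PT_nth => //; apply: PT_add (PT_succ po) (PT_add (PT_mul pi po) pj).
Qed.

Lemma PT_valid G {cG : ctx G} (x : G -> bits) : PT x -> PT (fun g => valid (x g)).
Proof.
move=> px; have po := PT_order px.
apply: PT_and; first exact: PT_leq (PT_const 1) po.
apply: PT_and; first exact: PT_neg (PT_odd po).
apply: PT_and; first exact: PT_eqn (PT_size_bits px) (PT_add (PT_succ po) (PT_mul po po)).
apply: PT_all => //.
have px1 := @PT_weak _ _ nat code_nat _ _ _ px.
apply: PT_and; first by apply: PT_neg; exact: PT_adj px1 PT_last PT_last.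
apply: PT_all; first exact: PT_order px1.
have px2 := @PT_weak _ _ nat code_nat _ _ _ px1.
exact: PT_eqb (PT_adj px2 PT_prev PT_last) (PT_adj px2 PT_last PT_prev).
Qed.

Lemma PT_edges G {cG : ctx G} (x : G -> bits) : PT x -> PT (fun g => edges (x g)).
Proof.
move=> px; have px1 := @PT_weak _ _ nat code_nat _ _ _ px.
have px2 := @PT_weak _ _ nat code_nat _ _ _ px1.
apply: PT_sum (PT_order px) _; apply: PT_sum (PT_order px1) _.
exact: PT_nat_of_bool (PT_adj px2 PT_prev PT_last).
Qed.

Lemma PT_cone_code G {cG : ctx G} (x : G -> bits) :
  PT x -> PT (fun g => cone_code (x g)).
Proof.
move=> px; have px1 := @PT_weak _ _ nat code_nat _ _ _ px.
have px2 := @PT_weak _ _ nat code_nat _ _ _ px1.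
apply: PT_cat; first exact: PT_ones (PT_succ (PT_order px)).
apply: PT_cons1; apply: PT_flatten (PT_succ (PT_order px)) _.
apply: PT_flatten (PT_succ (PT_order px1)) _.
apply: PT_delim; apply: PT_nat_bits; rewrite /cone_weight.
apply: PT_if; first exact: PT_or (PT_eq0 PT_prev) (PT_eq0 PT_last).
  apply: PT_if; first exact: PT_eqn PT_prev PT_last.
    exact: PT_const.
  exact: PT_mul (PT_succ (PT_order px2)) (PT_succ (PT_order px2)).
exact: PT_nat_of_bool (PT_adj px2 (PT_pred PT_prev) (PT_pred PT_last)).
Qed.

Lemma PT_accepts G {cG : ctx G} (x y : G -> bits) :
  PT x -> PT y -> PT (fun g => accepts (x g) (y g)).
Proof.
move=> px py; have po := PT_order px; have pe := PT_edges px.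
have py' := PT_behead py.
have pa := PT_delim_head py'; have pd := PT_delim_head (PT_delim_rest py').
have pN := PT_succ po; have pN2 := PT_mul pN pN.
have c k : PT (fun _ : G => k : nat) by exact: PT_const.
have pb : PT (fun g => test_bound (order (x g)) (edges (x g))).
  apply: PT_add (c 1); apply: PT_mul (c _) _.
  by apply: PT_sub (PT_mul (c 2) pe); apply: PT_mul (PT_mul (c 4) pN2) (PT_mul po po).
have pt : PT (fun g => test_coef (order (x g)) (edges (x g))).
  apply: PT_mul; first by apply: PT_mul; exact: PT_mul (c _) pN.
  by apply: PT_add pe; exact: PT_mul (PT_mul (c 2) po) (PT_mul pN2 pN2).
apply: PT_or (PT_head py) _.
apply: PT_bleq (PT_bmul (PT_bmul pa pa) (PT_nat_bits pt)) _.
exact: PT_bmul (PT_bmul pd pd) (PT_nat_bits (PT_mul pb pb)).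
Qed.

(** * The discrete Fourier transform in two dimensions *)

Local Open Scope ring_scope.
Local Open Scope complex_scope.
Local Notation Re := complex.Re.
Local Notation Im := complex.Im.

Section Complex.
Variable R : realType.
Implicit Types (z : R[i]) (a b : R).

Lemma normcE z : normc z = Num.sqrt (Re z ^+ 2 + Im z ^+ 2).
Proof. by case: z. Qed.

Lemma normc_sqr z : normc z ^+ 2 = Re z ^+ 2 + Im z ^+ 2.
Proof. by rewrite normcE sqr_sqrtr // addr_ge0 // sqr_ge0. Qed.

Lemma normc_mulcJ z : (normc z ^+ 2)%:C = z * conjc z.
Proof.
rewrite normc_sqr; case: z => a b /=; apply/eqP; rewrite eq_complex /=.
by apply/andP; split; apply/eqP; ring.
Qed.

Lemma normc_real a : normc a%:C = `|a|.
Proof. by rewrite normcE /= expr0n addr0 sqrtr_sqr. Qed.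

Lemma ler_ReN_normc z : `|Re z| <= normc z.
Proof. by rewrite normcE -sqrtr_sqr ler_sqrt ?lerDl ?sqr_ge0 // addr_ge0 ?sqr_ge0. Qed.

Lemma normc_sum (I : Type) (r : seq I) (P : pred I) (F : I -> R[i]) :
  normc (\sum_(i <- r | P i) F i) <= \sum_(i <- r | P i) normc (F i).
Proof.
elim/big_ind2: _ => [|x u y v ux vy|//]; first by rewrite normc0.
by apply: le_trans (le_normcD _ _) _; exact: lerD.
Qed.

Lemma Re_sum (I : Type) (r : seq I) (P : pred I) (F : I -> R[i]) :
  Re (\sum_(i <- r | P i) F i) = \sum_(i <- r | P i) Re (F i).
Proof. by apply: (big_morph (@Re R)) => // -[a b] [c d]. Qed.

Lemma realc_sum (I : Type) (r : seq I) (P : pred I) (F : I -> R) :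
  (\sum_(i <- r | P i) F i)%:C = \sum_(i <- r | P i) (F i)%:C :> R[i].
Proof. exact: rmorph_sum. Qed.

Lemma Re_realM a z : Re (a%:C * z) = a * Re z.
Proof. by case: z => b c /=; rewrite mul0r subr0. Qed.

Lemma cisD a b : cis (a + b) = cis a * cis b.
Proof.
rewrite /cis cosD sinD; apply/eqP; rewrite eq_complex /=.
by apply/andP; split; apply/eqP; ring.
Qed.

Lemma cis0 : cis (0 : R) = 1.
Proof. by rewrite /cis cos0 sin0. Qed.

Lemma cisN a : cis (- a) = conjc (cis a).
Proof. by rewrite /cis cosN sinN. Qed.

Lemma normc_cis a : normc (cis a) = 1.
Proof. by rewrite normcE /= cos2Dsin2 sqrtr1. Qed.

End Complex.

Section Characters.
Variables (R : realType) (k : nat).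
Local Notation N := k.+2.
Local Notation Z := 'I_k.+2.

Definition psi (a : Z) : R[i] := cis (- (2 * pi * (a : nat)%:R / N%:R)).

Lemma cis_mod (m : nat) :
  cis (- (2 * pi * (m %% N)%N%:R / N%:R)) = cis (- (2 * pi * m%:R / N%:R)) :> R[i].
Proof.
rewrite [in RHS](divn_eq m N) natrD natrM.
have N0 : N%:R != 0 :> R by rewrite pnatr_eq0.
set q := (m %/ N)%N; set r := (m %% N)%N.
have -> : - (2 * pi * (q%:R * N%:R + r%:R) / N%:R) =
    - (2 * pi * r%:R / N%:R) + - (q%:R * (pi *+ 2)) :> R.
  by rewrite mulr2n; move: N%:R N0 => n' N0; field.
rewrite cisD; suff -> : cis (- (q%:R * (pi *+ 2))) = 1 :> R[i] by rewrite mulr1.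
elim: q => [|q IH]; first by rewrite mul0r oppr0 cis0.
rewrite -natr1 mulrDl opprD cisD IH mul1r cisN mul1r /cis cos2pi sin2pi.
by rewrite /= oppr0.
Qed.

Lemma psiD a b : psi (a + b) = psi a * psi b.
Proof.
rewrite /psi -cisD /= cis_mod; congr cis; rewrite natrD.
by rewrite mulrDr mulrDl opprD.
Qed.

Lemma psi0 : psi 0 = 1.
Proof. by rewrite /psi /= mulr0 mul0r oppr0 cis0. Qed.

Lemma psiM a b : psi (a * b) = cis (- (2 * pi * (a * b)%N%:R / N%:R)).
Proof. by rewrite /psi /= cis_mod. Qed.

Lemma normc_psi a : normc (psi a) = 1.
Proof. exact: normc_cis. Qed.

Lemma psiN a : psi (- a) = conjc (psi a).
Proof.
have psi1 : psi a * conjc (psi a) = 1.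
  by rewrite -normc_mulcJ normc_psi expr1n.
have psi2 : psi a * psi (- a) = 1 by rewrite -psiD subrr psi0.
have n0 : psi a != 0.
  by apply: contra_eq_neq psi1 => ->; rewrite mul0r eq_sym oner_eq0.
by apply: (mulfI n0); rewrite psi1 psi2.
Qed.

(** With [t = pi * a / N] strictly between 0 and [pi], the real part is [1 - 2 * sin t ^ 2], which
    is less than 1. *)
Lemma psi_neq1 a : a != 0 -> psi a != 1.
Proof.
move=> a0; rewrite /psi /cis eq_complex /= negb_and; apply/orP; left.
have N0 : 0 < N%:R :> R by rewrite ltr0n.
set t : R := pi * (a : nat)%:R / N%:R.
have -> : - (2 * pi * (a : nat)%:R / N%:R) = - (t *+ 2) :> R.
  by rewrite /t mulr2n; move: N%:R N0 => n' N0; field; rewrite gt_eqF.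
rewrite cosN cos_mulr2n cos2sin2.
have a_gt0 : 0 < (a : nat)%:R :> R by rewrite ltr0n lt0n; exact: a0.
have s0 : 0 < sin t.
  apply: sin_gt0_pi; rewrite /t; apply/andP; split.
    by rewrite divr_gt0 // mulr_gt0 // pi_gt0.
  by rewrite ltr_pdivrMr // ltr_pM2l ?pi_gt0 // ltr_nat ltn_ord.
apply/eqP => e; have : sin t ^+ 2 = 0 by rewrite mulr2n in e; lra.
by move/eqP; rewrite expf_eq0 /= gt_eqF.
Qed.

Lemma sum_psi (x : Z) : \sum_(r : Z) psi (r * x) = (if x == 0 then N%:R else 0).
Proof.
case: eqP => [->|/eqP x0].
  under eq_bigr do rewrite mulr0 psi0.
  by rewrite sumr_const card_ord.
have : (psi x - 1) * \sum_r psi (r * x) = 0.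
  rewrite mulrBl mul1r mulr_sumr; apply/eqP; rewrite subr_eq0; apply/eqP.
  under eq_bigr do rewrite -psiD -{1}[x]mul1r -mulrDl.
  rewrite [RHS](reindex (fun r : Z => 1 + r)) //=.
  by exists (fun r => r - 1) => r _; [rewrite addrAC subrr add0r | rewrite addrC subrK].
move/eqP; rewrite mulf_eq0 subr_eq0 (negbTE (psi_neq1 x0)) /= => /eqP.
by [].
Qed.

Local Notation P := (Z * Z)%type.

Definition psi2 (p q : P) : R[i] := psi (p.1 * q.1 + p.2 * q.2).

(** The matrix [dft] stands on both sides without a conjugate, so the transform of a matrix is the
    one of the group of pairs of residues. Here it is left unnormalized, which is [N] times the
    matrix product. *)
Definition fourier2 (f : P -> R) (p : P) : R[i] := \sum_q (f q)%:C * psi2 p q.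

Lemma psi2C p q : psi2 p q = psi2 q p.
Proof. by rewrite /psi2 ![_ * q.1]mulrC ![_ * q.2]mulrC. Qed.

Lemma psi2B p q q' : psi2 p (q - q') = psi2 p q * conjc (psi2 p q').
Proof.
rewrite /psi2  -psiN -psiD; congr psi => /=; ring.
Qed.

Lemma psi2N p q : psi2 (- p) q = psi2 p (- q).
Proof. by rewrite /psi2 /= !mulNr !mulrN. Qed.

Lemma sum_psi2 (q : P) :
  \sum_p psi2 p q = if q == 0 then N%:R ^+ 2 else 0.
Proof.
rewrite -(pair_bigA _ (fun r v => psi2 (r, v) q)) /=.
under eq_bigr => r _ do
  [under eq_bigr do rewrite /psi2 psiD /=; rewrite -mulr_sumr sum_psi].
rewrite -mulr_suml sum_psi; case: q => x y /=; rewrite -[(x, y) == 0]/((x == 0) && (y == 0)).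
by case: (x == 0); case: (y == 0); rewrite ?mulr0 ?mul0r // expr2.
Qed.

Lemma parseval (f : P -> R) :
  \sum_p normc (fourier2 f p) ^+ 2 = N%:R ^+ 2 * \sum_q f q ^+ 2.
Proof.
apply: (@complexI R); rewrite realc_sum.
have E p : (normc (fourier2 f p) ^+ 2)%:C =
    \sum_q \sum_q' ((f q * f q')%:C * psi2 p (q - q')).
  rewrite normc_mulcJ /fourier2 rmorph_sum mulr_suml; apply: eq_bigr => q _.
  rewrite mulr_sumr; apply: eq_bigr => q' _.
  by rewrite !rmorphM psi2B mulrACA; congr (_ * _ * _); exact: conjc_real.
under eq_bigr do rewrite E.
rewrite exchange_big /= rmorphM /= realc_sum mulr_sumr; apply: eq_bigr => q _.
rewrite exchange_big /= (bigD1 q) //= [X in _ + X]big1 ?addr0 => [|q' qq'].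
  rewrite -mulr_sumr sum_psi2 subrr eqxx mulrC; congr (_ * _).
  by rewrite rmorphXn /= rmorph_nat.
by rewrite -mulr_sumr sum_psi2 subr_eq0 eq_sym (negbTE qq') mulr0.
Qed.

End Characters.

Section Fourier2.
Variables (R : realType) (k : nat).
Local Notation N := k.+2.
Local Notation Z := 'I_k.+2.
Local Notation P := (Z * Z)%type.
Implicit Types (f g : P -> R) (p q : P).

Lemma eq_fourier2 f g : f =1 g -> fourier2 f =1 fourier2 g.
Proof. by move=> fg p; apply: eq_bigr => q _; rewrite fg. Qed.

Lemma fourier2D f g p :
  fourier2 (fun q => f q + g q) p = fourier2 f p + fourier2 g p.
Proof.
by rewrite -big_split; apply: eq_bigr => q _; rewrite rmorphD mulrDl.
Qed.

Lemma fourier2Z a f p : fourier2 (fun q => a * f q) p = a%:C * fourier2 f p.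
Proof.
by rewrite /fourier2 mulr_sumr; apply: eq_bigr => q _; rewrite rmorphM mulrA.
Qed.

Lemma fourier2_conj f p : conjc (fourier2 f p) = fourier2 f (- p).
Proof.
rewrite /fourier2 rmorph_sum; apply: eq_bigr => q _; rewrite rmorphM.
congr (_ * _); first exact: conjc_real.
by rewrite psi2N /psi2 /= !mulrN -opprD psiN.
Qed.

Lemma fourier2N f p : fourier2 (fun q => f (- q)) p = fourier2 f (- p).
Proof.
rewrite /fourier2 (reindex (fun q : P => - q)) /=.
  by apply: eq_bigr => q _; rewrite opprK psi2N.
by exists (fun q : P => - q) => q _; exact: opprK.
Qed.

Lemma fourier2_norm f p : (forall q, 0 <= f q) ->
  normc (fourier2 f p) <= \sum_q f q.
Proof.
move=> f0; apply: le_trans (normc_sum _ _ _) _; apply: ler_sum => q _.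
by rewrite normcM normc_real normc_psi mulr1 ger0_norm.
Qed.

Lemma sum_pairE (T : nmodType) (F : Z -> Z -> T) :
  \sum_(q : P) F q.1 q.2 = \sum_x \sum_y F x y.
Proof. by rewrite (pair_bigA _ F). Qed.

(** A function of one coordinate has its transform supported on an axis. Corrections of this kind
    therefore leave the transform unchanged off the axes. *)
Lemma fourier2_fst (a : Z -> R) p :
  fourier2 (fun q => a q.1) p =
  (\sum_x (a x)%:C * psi R (p.1 * x)) * (if p.2 == 0 then N%:R else 0).
Proof.
rewrite /fourier2 (sum_pairE (fun x y => (a x)%:C * psi2 R p (x, y))).
rewrite mulr_suml; apply: eq_bigr => x _; rewrite -mulr_sumr -mulrA; congr (_ * _).
rewrite -sum_psi mulr_sumr; apply: eq_bigr => y _.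
by rewrite /psi2 psiD /= [p.2 * y]mulrC.
Qed.

Lemma fourier2_snd (a : Z -> R) p :
  fourier2 (fun q => a q.2) p =
  (\sum_x (a x)%:C * psi R (p.2 * x)) * (if p.1 == 0 then N%:R else 0).
Proof.
rewrite -[p.1]/(p.2, p.1).2 -[p.2]/(p.2, p.1).1 -fourier2_fst /fourier2.
rewrite (sum_pairE (fun x y => (a y)%:C * psi2 R p (x, y))) exchange_big /=.
rewrite (sum_pairE (fun x y => (a x)%:C * psi2 R (p.2, p.1) (x, y))).
by apply: eq_bigr => y _; apply: eq_bigr => x _; rewrite /psi2 /= addrC.
Qed.

Definition ind1 (q : P) : R := (q.1 == 0)%:R.
Definition ind2 (q : P) : R := (q.2 == 0)%:R.
Definition ind0 (q : P) : R := (q == 0)%:R.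

Lemma ind0E q : ind0 q = ind1 q * ind2 q.
Proof.
rewrite /ind0 /ind1 /ind2; case: q => x y; rewrite -[_ == 0]/((x == 0) && (y == 0)).
by case: (x == 0); case: (y == 0); rewrite ?mulr0 ?mulr1.
Qed.

Lemma sum_delta (c : Z -> R[i]) : \sum_x (((x == 0)%:R : R)%:C * c x) = c 0.
Proof.
rewrite (bigD1 0) // eqxx mul1r big1 => [|x /negbTE ->]; first exact: addr0.
by rewrite mul0r.
Qed.

Lemma fourier2_ind1 p : fourier2 ind1 p = (N%:R * ind2 p)%:C.
Proof.
rewrite (fourier2_fst (fun x => (x == 0)%:R)) sum_delta mulr0 psi0 mul1r.
rewrite rmorphM /= rmorph_nat /ind2; case: eqP => _; by rewrite ?mulr1 ?mulr0.
Qed.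

Lemma fourier2_ind2 p : fourier2 ind2 p = (N%:R * ind1 p)%:C.
Proof.
rewrite (fourier2_snd (fun x => (x == 0)%:R)) sum_delta mulr0 psi0 mul1r.
rewrite rmorphM /= rmorph_nat /ind1; case: eqP => _; by rewrite ?mulr1 ?mulr0.
Qed.

Lemma fourier2_ind0 p : fourier2 ind0 p = (1 : R)%:C.
Proof.
rewrite /fourier2 (bigD1 (0 : P)) // big1 => [|q /negbTE q0].
  by rewrite [LHS]addr0 /ind0 eqxx mul1r /psi2 /= !mulr0 addr0 psi0.
by rewrite /ind0 q0 mul0r.
Qed.

Lemma fourier2_1 p : fourier2 (fun _ => 1) p = (N%:R ^+ 2 * ind0 p)%:C.
Proof.
rewrite /fourier2; under eq_bigr do rewrite mul1r psi2C.
rewrite sum_psi2 /ind0; case: eqP => _; rewrite ?mulr1 ?mulr0 //.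
by rewrite rmorphXn /= rmorph_nat.
Qed.

Lemma sum_fourier2_0 f : (\sum_q f q)%:C = fourier2 f 0.
Proof.
rewrite realc_sum; apply: eq_bigr => q _.
by rewrite /psi2 /= !mul0r addr0 psi0 mulr1.
Qed.

Lemma sum_ind1 : \sum_q ind1 q = N%:R.
Proof.
apply: (@complexI R); rewrite sum_fourier2_0 fourier2_ind1.
by rewrite /ind2 eqxx mulr1.
Qed.

Lemma sum_ind2 : \sum_q ind2 q = N%:R.
Proof.
apply: (@complexI R); rewrite sum_fourier2_0 fourier2_ind2.
by rewrite /ind1 eqxx mulr1.
Qed.

Lemma sum_ind0 : \sum_q ind0 q = 1.
Proof. by apply: (@complexI R); rewrite sum_fourier2_0 fourier2_ind0. Qed.

(* The signs of the transform of a cone labelled with its apex at [0]. *)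
Definition sign (p : P) : R := 2 * ind1 p + 2 * ind2 p - 2 * ind0 p - 1.

Lemma signE p : sign p = if (p.1 == 0) || (p.2 == 0) then 1 else -1.
Proof.
rewrite /sign ind0E /ind1 /ind2; case: (p.1 == 0); case: (p.2 == 0) => /=; ring.
Qed.

Lemma fourier2_sign p : fourier2 sign p =
  (2 * N%:R * ind1 p + 2 * N%:R * ind2 p - 2 - N%:R ^+ 2 * ind0 p)%:C.
Proof.
rewrite (@eq_fourier2 _ (fun q => (2 * ind1 q + 2 * ind2 q) +
  ((-2) * ind0 q + (-1) * 1))); last by move=> q; rewrite /sign; ring.
rewrite !fourier2D !fourier2Z fourier2_ind1 fourier2_ind2 fourier2_ind0 fourier2_1.
rewrite -!rmorphM -!rmorphD /=; congr (_%:C); ring.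
Qed.

(** The kernel is symmetric, so the transform can be moved from [f] to [sign]. The factor obtained
    equals [- 2] off the axes, hence entries there count only through their sum. *)
Lemma sum_sign f : \sum_p sign p * Re (fourier2 f p) =
  \sum_q f q * (2 * N%:R * ind1 q + 2 * N%:R * ind2 q - 2 - N%:R ^+ 2 * ind0 q).
Proof.
transitivity (Re (\sum_p (sign p)%:C * fourier2 f p)).
  by rewrite Re_sum; apply: eq_bigr => p _; rewrite Re_realM.
have -> : \sum_p (sign p)%:C * fourier2 f p = \sum_q (f q)%:C * fourier2 sign q.
  under eq_bigr do rewrite mulr_sumr.
  rewrite exchange_big; apply: eq_bigr => q _; rewrite mulr_sumr.
  by apply: eq_bigr => p _; rewrite mulrCA psi2C.
rewrite Re_sum; apply: eq_bigr => q _.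
by rewrite fourier2_sign Re_realM.
Qed.

End Fourier2.

(** * The 1-norm of the transform of a labelled cone *)

Section Cone.
Variables (R : realType) (k : nat).
Local Notation N := k.+2.
Local Notation Z := 'I_k.+2.
Local Notation P := (Z * Z)%type.

(** What is retained of a labelled cone whose apex sits at 0. The base is arbitrary, so all
    estimates are uniform in the labeling. *)
Record cone_like (f : P -> nat) : Prop := ConeLike {
  cone_sym : forall x y, f (x, y) = f (y, x);
  cone_diag : forall x, f (x, x) = 0%N;
  cone_apex : forall y, y != 0 -> f (0, y) = (N * N)%N;
  cone_base : forall x y, x != 0 -> y != 0 -> (f (x, y) <= 1)%N }.

Variable f : P -> nat.
Hypothesis fcone : cone_like f.
Hypothesis N3 : (3 <= N)%N.

Local Notation Nr := (N%:R : R).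
Let F (q : P) : R := (f q)%:R.
Let D := fourier2 F.

Definition base (q : P) : R := if (q.1 == 0) || (q.2 == 0) then 0 else (f q)%:R.
Let E := \sum_q base q.

Let Nr3 : 3 <= Nr. Proof. by rewrite ler_nat. Qed.

(** The star is [N ^ 2] times the two axes, corrected at the apex, where both indicators equal 1 but
    the weight is 0. This correction transforms to the constant [- 2 * N ^ 2], which is what makes
    real parts negative off the axes. *)
Lemma cone_decomp q :
  F q = Nr ^+ 2 * (ind1 R q + ind2 R q - 2 * ind0 R q) + base q.
Proof.
case: q => x y; rewrite ind0E /base /F /ind1 /ind2 /=.
have [->|x0] := eqVneq x 0; have [->|y0] := eqVneq y 0 => /=.
- by rewrite (cone_diag fcone); ring.
- by rewrite (cone_apex fcone) // natrM; ring.
- by rewrite (cone_sym fcone) (cone_apex fcone) // natrM; ring.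
- by ring.
Qed.

Lemma base_ge0 q : 0 <= base q.
Proof. by rewrite /base; case: ifP => // _; rewrite ler0n. Qed.

Lemma base_le q : base q <= 1 - ind1 R q - ind2 R q + ind0 R q.
Proof.
case: q => x y; rewrite ind0E /base /ind1 /ind2 /=.
have [->|x0] := eqVneq x 0; have [->|y0] := eqVneq y 0 => /=; try by lra.
have := cone_base fcone x0 y0; rewrite -(ler_nat R); lra.
Qed.

Lemma sum_base_le : E <= (Nr - 1) ^+ 2.
Proof.
apply: le_trans (ler_sum _ (fun q _ => base_le q)) _.
rewrite !big_split /= !sumrN sum_ind1 sum_ind2 sum_ind0 sumr_const.
rewrite card_prod card_ord mulrnA -mulr_natl expr2; lra.
Qed.

(** This is the number [A]; the term [- 2 * E] comes from the value [- 2] of the transformed signs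
    off the axes. *)
Definition cone_norm1 : R := 4 * Nr ^+ 2 * (Nr - 1) ^+ 2 - 2 * E.

Lemma sum_sign_cone : \sum_p sign R p * Re (D p) = cone_norm1.
Proof.
rewrite sum_sign.
transitivity (\sum_q ((2 * Nr - 2) * Nr ^+ 2 * ind1 R q +
  (2 * Nr - 2) * Nr ^+ 2 * ind2 R q + (- 4) * (Nr - 1) * Nr ^+ 2 * ind0 R q +
  (-2) * base q)).
  apply: eq_bigr => -[x y] _; rewrite cone_decomp !ind0E /base /ind1 /ind2 /=.
  by case: (x == 0); case: (y == 0) => /=; ring.
rewrite !big_split /= -!mulr_sumr sum_ind1 sum_ind2 sum_ind0 /cone_norm1 -/E; ring.
Qed.

Lemma fourier2_cone p :
  D p = (Nr ^+ 2 * (Nr * ind1 R p + Nr * ind2 R p - 2))%:C + fourier2 base p.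
Proof.
rewrite /D (@eq_fourier2 _ _ _ (fun q => (Nr ^+ 2 * ind1 R q + Nr ^+ 2 * ind2 R q) +
  ((-2 * Nr ^+ 2) * ind0 R q + base q))); last first.
  by move=> q; rewrite cone_decomp; ring.
rewrite !fourier2D !fourier2Z fourier2_ind1 fourier2_ind2 fourier2_ind0.
rewrite addrA -!rmorphM -!rmorphD /=; congr (_%:C + _); ring.
Qed.

Lemma fourier2_base_norm p : normc (fourier2 base p) <= (Nr - 1) ^+ 2.
Proof. exact: le_trans (fourier2_norm _ base_ge0) sum_base_le. Qed.

(** The star contributes [N ^ 2 * (2 * N - 2)] at the origin, [N ^ 2 * (N - 2)] on the rest of the
    axes and [- 2 * N ^ 2] elsewhere. The base contributes at most [(N - 1) ^ 2] in modulus, which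
    is dominated in each case as [N] is at least 3. *)
Lemma sign_Re_ge0 p : 0 <= sign R p * Re (D p).
Proof.
have := le_trans (ler_ReN_normc _) (fourier2_base_norm p).
rewrite ler_norml => /andP[lo hi].
rewrite fourier2_cone signE /ind1 /ind2.
have -> a z : Re (a%:C + z) = a + Re z by case: z.
move: (Re _) lo hi => c lo hi; have := Nr3; move: Nr lo hi => r lo hi r3.
have h1 : (r - 1) ^+ 2 <= r ^+ 2 * (r - 2) by nra.
have h2 : (r - 1) ^+ 2 <= 2 * r ^+ 2 by nra.
by case: (p.1 == 0); case: (p.2 == 0);
  rewrite /= ?mulr1 ?mulr0 ?addr0 ?add0r ?sub0r ?mul1r ?mulN1r; nra.
Qed.

Lemma cone_norm1_symmetric : (forall q, f (- q) = f q) ->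
  \sum_p normc (D p) = cone_norm1.
Proof.
move=> fN; rewrite -sum_sign_cone; apply: eq_bigr => p _.
have : conjc (D p) = D p.
  rewrite /D fourier2_conj -fourier2N; apply: eq_fourier2 => q.
  by rewrite /F fN.
have := sign_Re_ge0 p; rewrite signE; case: (D p) => a b /= s [bb].
have -> : b = 0 by lra.
rewrite expr0n addr0 sqrtr_sqr; case: ifP s => _ s.
  by rewrite mul1r in s *; rewrite ger0_norm.
by rewrite mulN1r in s *; rewrite ler0_norm //; lra.
Qed.

(** * The gap for labelings without reflection symmetry *)

Lemma ler_normc_Im (z : R[i]) (B : R) : 0 < B -> normc z <= B ->
  - Re z + Im z ^+ 2 / (2 * B) <= normc z.
Proof.
move=> B0 zB; have e := normc_sqr z; have l := ler_ReN_normc z.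
rewrite ler_norml in l; case/andP: l => l1 l2.
(* The product of [normc z + Re z] and [normc z - Re z] is [Im z ^ 2], and the second factor is at
   most [2 * B]. *)
rewrite -lerBrDl ler_pdivrMr ?mulr_gt0 //.
nra.
Qed.

(** Twice the odd part of the weights; its transform is [D - conjc D]. It vanishes when a coordinate
    is 0, since the weights of the star are constant. *)
Let u (q : P) : R := F q - F (- q).
Let d (x : Z) : R := \sum_y u (x, y).
(* The transform of [b] agrees with that of [u] off the axes and vanishes on
   them, so that Parseval's identity for [b] gives the energy off the axes. *)
Let b (q : P) : R := u q - (d q.1 + d q.2) / Nr.

Let u_sym x y : u (x, y) = u (y, x).
Proof. by congr (_%:R - _%:R); exact: cone_sym. Qed.

Let u0 y : u (0, y) = 0.
Proof.
rewrite /u /F -[(- (0, y))]/(- 0, - y) oppr0.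
have [->|y0] := eqVneq y 0; first by rewrite oppr0 subrr.
by rewrite !(cone_apex fcone) ?subrr // oppr_eq0.
Qed.

Let udiag x : u (x, x) = 0.
Proof. by rewrite /u /F -[(- (x, x))]/(- x, - x) !(cone_diag fcone) subrr. Qed.

Let d0 : d 0 = 0.
Proof. by rewrite /d big1 // => y _; exact: u0. Qed.

Let sum_d : \sum_x d x = 0.
Proof.
rewrite /d -(sum_pairE (fun x y => u (x, y))).
under eq_bigr => q _ do rewrite -surjective_pairing.
rewrite sumrB; apply/eqP; rewrite subr_eq0; apply/eqP.
rewrite (reindex (fun q : P => - q)) //=.
by exists (fun q : P => - q) => q _; exact: opprK.
Qed.

Let b_sym x y : b (x, y) = b (y, x).
Proof. by rewrite /b u_sym addrC /= [d y + _]addrC addrC. Qed.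

(** The correction [d x / N] centres row [x], and the other one sums to 0 over the row by [sum_d].
    Null row and column sums make the transform vanish on the axes. *)
Let sum_b x : \sum_y b (x, y) = 0.
Proof.
have N0 : Nr != 0 by rewrite pnatr_eq0.
rewrite /b sumrB -/(d x) /= -mulr_suml big_split /= sum_d sumr_const card_ord.
by rewrite addr0 -[d x *+ N]mulr_natr mulfK // subrr.
Qed.

Let fourier2_b_axis p : (p.1 == 0) || (p.2 == 0) -> fourier2 b p = 0.
Proof.
have h r : fourier2 b (r, 0) = 0.
  rewrite /fourier2.
  transitivity (\sum_(q : P) (b (q.1, q.2))%:C * psi R (r * q.1)).
    by apply: eq_bigr => -[x y] _; rewrite /psi2 /= mul0r addr0.
  rewrite (sum_pairE (fun x y => (b (x, y))%:C * psi R (r * x))) big1 // => x _.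
  by rewrite -mulr_suml -realc_sum sum_b mul0r.
have h' v : fourier2 b (0, v) = 0.
  rewrite -(h v) /fourier2.
  transitivity (\sum_(q : P) (b (q.1, q.2))%:C * psi R (v * q.2)).
    by apply: eq_bigr => -[x y] _; rewrite /psi2 /= mul0r add0r.
  transitivity (\sum_(q : P) (b (q.1, q.2))%:C * psi R (v * q.1)).
    rewrite (sum_pairE (fun x y => (b (x, y))%:C * psi R (v * y))) exchange_big /=.
    rewrite (sum_pairE (fun x y => (b (x, y))%:C * psi R (v * x))).
    by apply: eq_bigr => y _; apply: eq_bigr => x _; rewrite b_sym.
  by apply: eq_bigr => -[x y] _; rewrite /psi2 /= mul0r addr0.
by case: p => r v /= /orP[/eqP ->|/eqP ->].
Qed.

Let fourier2_b_off p : p.1 != 0 -> p.2 != 0 ->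
  normc (fourier2 b p) ^+ 2 = 4 * Im (D p) ^+ 2.
Proof.
move=> p1 p2.
have -> : fourier2 b p = D p - conjc (D p).
  rewrite /D fourier2_conj -fourier2N.
  rewrite (@eq_fourier2 _ _ _ (fun q => (F q + (-1) * F (- q)) +
    ((- Nr^-1) * d q.1 + (- Nr^-1) * d q.2))); last first.
    by move=> q; rewrite /b /u; ring.
  rewrite !fourier2D !fourier2Z fourier2_fst fourier2_snd (negbTE p1) (negbTE p2).
  by rewrite !mulr0 addr0 addr0 rmorphN1 mulN1r.
rewrite normc_sqr; case: (D p) => x y /=; ring.
Qed.

(** Let the symmetry fail at [(x, y)]. If a row sum [d z] with [z] equal to [x] or [y] is at least
    [N / 4] in absolute value, the corrections alone give [(1 + 1 + 4) / 16 = 3 / 8]. Otherwise the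
    correction at [(x, y)] is at most 1/2 while [u] is 1 or -1 there, so [(x, y)] and [(y, x)]
    contribute at least 1/4 each. *)
Let sum_b_sqr : (exists q, f (- q) != f q) -> 3 / 8 <= \sum_q b q ^+ 2.
Proof.
case=> -[x y]; rewrite -[- (x, y)]/(- x, - y) => fq.
have uxy : u (x, y) != 0.
  by rewrite /u /F subr_eq0 -[- (x, y)]/(- x, - y) eqr_nat eq_sym.
have x0 : x != 0 by apply: contraNneq uxy => ->; rewrite u0.
have y0 : y != 0 by apply: contraNneq uxy => ->; rewrite u_sym u0.
have xy : x != y by apply: contraNneq uxy => ->; rewrite udiag.
(* The entries [(0, z)], [(z, 0)] and [(z, z)] of [b] are [- d z / N],
   [- d z / N] and [- 2 d z / N]. *)
have big z : z != 0 -> Nr / 4 <= `|d z| -> 3 / 8 <= \sum_q b q ^+ 2.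
  move=> z0 dz.
  have nz : (0, z) != (z, 0) :> P by rewrite xpair_eqE eq_sym (negbTE z0).
  have nz1 : (0, z) != (z, z) :> P by rewrite xpair_eqE eq_sym (negbTE z0).
  have nz2 : (z, 0) != (z, z) :> P by rewrite xpair_eqE eqxx eq_sym (negbTE z0).
  rewrite (bigD1 (0, z)) //= (bigD1 (z, 0)) 1?eq_sym //=.
  rewrite (bigD1 (z, z)) /=; last by rewrite ![(z, z) == _]eq_sym nz1 nz2.
  rewrite /b /= udiag u0 (u_sym z 0) u0 d0 !sub0r.
  set s := \sum_(_ | _) _.
  have s0 : 0 <= s by apply: sumr_ge0 => q _; exact: sqr_ge0.
  set c := d z / Nr.
  have c2 : 1 / 16 <= c ^+ 2.
    have N0 : 0 < Nr by rewrite ltr0n.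
    rewrite /c expr_div_n ler_pdivlMr ?exprn_gt0 // -(real_normK (num_real (d z))).
    have : (Nr / 4) ^+ 2 <= `|d z| ^+ 2 by rewrite ler_pXn2r // nnegrE; lra.
    lra.
  have -> : (0 + d z) / Nr = c by rewrite add0r.
  have -> : (d z + 0) / Nr = c by rewrite addr0.
  have -> : (d z + d z) / Nr = 2 * c by rewrite /c mulrDl mulrDl mul1r.
  nra.
have [|dx] := leP (Nr / 4) `|d x|; first exact: big.
have [|dy] := leP (Nr / 4) `|d y|; first exact: big.
have u1 : `|u (x, y)| = 1.
  move: uxy; rewrite /u /F -[- (x, y)]/(- x, - y).
  have := cone_base fcone x0 y0.
  have := @cone_base _ fcone (- x) (- y); rewrite !oppr_eq0 => /(_ x0 y0).
  by case: (f (x, y)) => [|[|]] //; case: (f (- x, - y)) => [|[|]] // _ _;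
    rewrite ?subrr ?eqxx // ?subr0 ?sub0r ?normrN normr1.
have bxy : 1 / 4 <= b (x, y) ^+ 2.
  have : `|(d x + d y) / Nr| <= 1 / 2.
    have N0 : 0 < Nr by rewrite ltr0n.
    rewrite normrM [`|Nr^-1|]gtr0_norm ?invr_gt0 // ler_pdivrMr //.
    apply: le_trans (ler_normD _ _) _; lra.
  rewrite /b /=; move: ((d x + d y) / Nr) => c; rewrite ler_norml => /andP[c1 c2].
  by move: u1; case: ger0P => _ u1; nra.
have nxy : (y, x) != (x, y) :> P by rewrite xpair_eqE eq_sym (negbTE xy).
rewrite (bigD1 (x, y)) //= (bigD1 (y, x)) //= -(b_sym x y).
set s := \sum_(_ | _) _.
have s0 : 0 <= s by apply: sumr_ge0 => q _; exact: sqr_ge0.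
lra.
Qed.

(** Off the axes [normc (D p)] is at most [2 * N ^ 2 + (N - 1) ^ 2], hence at most [B = 3 * N ^ 2],
    and the excess [Im ^ 2 / (2 * B)] is the squared modulus of the transform of [b] over
    [24 * N ^ 2]. Summing with Parseval's identity gives at least [(3 / 8) / 24 = 1 / 64]. *)
Lemma cone_norm1_asymmetric : (exists q, f (- q) != f q) ->
  cone_norm1 + 1 / 64 <= \sum_p normc (D p).
Proof.
move=> /sum_b_sqr bb.
have N0 : 0 < Nr by rewrite ltr0n.
have step p : sign R p * Re (D p) + normc (fourier2 b p) ^+ 2 / (24 * Nr ^+ 2)
    <= normc (D p).
  rewrite signE; have := ler_ReN_normc (D p); rewrite ler_norml => /andP[l1 l2].
  case: ifPn => [ax|]; first by rewrite fourier2_b_axis // normc0 expr0n mul0r mul1r addr0.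
  rewrite negb_or => /andP[p1 p2]; rewrite fourier2_b_off // mulN1r.
  have B0 : 0 < 3 * Nr ^+ 2 by rewrite mulr_gt0 // exprn_gt0.
  apply: le_trans (ler_normc_Im B0 _); last first.
    rewrite fourier2_cone; apply: le_trans (le_normcD _ _) _.
    have := fourier2_base_norm p.
    rewrite normc_real /ind1 /ind2 (negbTE p1) (negbTE p2) !mulr0 addr0 sub0r.
    have r3 := Nr3; have r2 : 0 <= Nr ^+ 2 * 2 by rewrite mulr_ge0 // sqr_ge0.
    rewrite mulrN normrN ger0_norm //; move: (normc _) => c hc; nra.
  rewrite lerD2l le_eqVlt; apply/orP; left; apply/eqP.
  by move: Nr N0 => r r0; field; rewrite gt_eqF.
apply: le_trans (ler_sum _ (fun p _ => step p)).
rewrite big_split /= sum_sign_cone lerD2l -mulr_suml parseval.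
rewrite ler_pdivlMr; last by rewrite mulr_gt0 // exprn_gt0.
have : 0 < Nr ^+ 2 by rewrite exprn_gt0.
nra.
Qed.

End Cone.

(** * Reflections and involutions *)

Section ConeMatrix.
Variables (n : nat) (e : rel 'I_n).

Lemma cone_lift u v : cone e (lift ord0 u) (lift ord0 v) = e u v :> nat.
Proof. by rewrite mxE !liftK. Qed.

Lemma cone_apexl v : cone e ord0 (lift ord0 v) = (n.+1 * n.+1)%N.
Proof. by rewrite mxE liftK unlift_none. Qed.

Lemma cone_apexr u : cone e (lift ord0 u) ord0 = (n.+1 * n.+1)%N.
Proof. by rewrite mxE liftK unlift_none. Qed.

Lemma cone_apex_apex : cone e ord0 ord0 = 0%N.
Proof. by rewrite mxE unlift_none. Qed.

Lemma sum_cone (V : nmodType) (g : nat -> V) :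
  \sum_i \sum_j g (cone e i j) =
  g 0%N + g (n.+1 * n.+1)%N *+ n + g (n.+1 * n.+1)%N *+ n +
  \sum_u \sum_v g (e u v).
Proof.
rewrite !big_ord_recl cone_apex_apex.
under eq_bigr do rewrite cone_apexl.
rewrite sumr_const card_ord -!addrA; congr (_ + (_ + _)).
under eq_bigr => u _.
  rewrite big_ord_recl cone_apexr.
  under eq_bigr do rewrite cone_lift.
  over.
by rewrite big_split /= sumr_const card_ord.
Qed.

Hypotheses (e_sym : symmetric e) (e_irr : irreflexive e).

Lemma coneC i j : cone e i j = cone e j i.
Proof.
case: (unliftP ord0 i) => [u ->|->]; case: (unliftP ord0 j) => [v ->|->].
- by rewrite !cone_lift e_sym.
- by rewrite cone_apexl cone_apexr.
- by rewrite cone_apexl cone_apexr.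
- by [].
Qed.

Lemma cone_irr i : cone e i i = 0%N.
Proof.
case: (unliftP ord0 i) => [u ->|->]; last exact: cone_apex_apex.
by rewrite cone_lift e_irr.
Qed.

Lemma cone_restricted : (0 < n)%N -> ~~ odd n -> restricted_adjacency (cone e).
Proof.
move=> n0 nodd.
have apex j : j != ord0 -> Defs.support (cone e) ord0 j.
  by case: (unliftP ord0 j) => [v -> _|-> /eqP//]; rewrite /Defs.support cone_apexl.
split=> //.
- split; [exact: coneC | exact: cone_irr |].
  exists ord0, (lift ord0 (Ordinal n0)); rewrite cone_apexl //.
- have to0 u : connect (Defs.support (cone e)) u ord0.
    have [->|u0] := eqVneq u ord0; first exact: connect0.
    by apply: connect1; rewrite /Defs.support coneC; exact: apex.
  move=> u v; apply: connect_trans (to0 u) _.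
  have [->|v0] := eqVneq v ord0; first exact: connect0.
  by apply: connect1; exact: apex.
- by exists (n.+1 ^ 2)%N => // u v; rewrite -mulnn;
    case: (unliftP ord0 u) => [u' ->|->]; case: (unliftP ord0 v) => [v' ->|->];
    rewrite ?cone_lift ?cone_apexl ?cone_apexr ?cone_apex_apex //;
    [case: (e u' v') => //; left | right | right].
Qed.

End ConeMatrix.

Section Reflections.
Variables (k : nat) (e : rel 'I_k.+1).
Local Notation n := k.+1.
Local Notation N := k.+2.
Local Notation Z := 'I_k.+2.
Hypothesis n_even : ~~ odd n.

(** The modulus [n + 1] is odd, so doubling is injective on residues. *)
Lemma opp_fixed (a : Z) : - a = a -> a = 0.
Proof.
move=> /eqP; rewrite eq_sym -addr_eq0 => /eqP/(congr1 val) /= h.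
apply: val_inj => /=; have := ltn_ord a; set m := val a in h * => mN.
have [//|m0] := posnP m.
have [l|l] := ltnP (m + m) N; first by rewrite modn_small in h; lia.
have : ((m + m - N + N) %% N = 0)%N by rewrite subnK.
rewrite modnDr modn_small; lia.
Qed.

(** The position [t] of the apex is the centre of the reflection, and [th] is this reflection
    carried to the vertices by the labeling. *)
Lemma involution_of_reflection (p : 'S_N) (t : Z) : p t = ord0 ->
  (forall x y, cone e (p (- x + t)) (p (- y + t)) =
               cone e (p (x + t)) (p (y + t))) ->
  exists tau : 'S_n, fpf_involutory_automorphism e tau.
Proof.
move=> pt sy; pose th i := p (- ((p^-1)%g i - t) + t).
have thK : involutive th.
  by move=> i; rewrite /th permK addrK opprK subrK permKV.
have th0 : th ord0 = ord0 by rewrite /th -{1}pt permK subrr oppr0 add0r.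
have thW i j : cone e (th i) (th j) = cone e i j.
  by rewrite /th sy !subrK !permKV.
have thfix i : th i = i -> i = ord0.
  move=> thi; have /opp_fixed/eqP : - ((p^-1)%g i - t) = (p^-1)%g i - t.
    by apply: (addIr t); apply: (@perm_inj _ p); rewrite subrK permKV.
  by rewrite subr_eq0 => /eqP h; rewrite -pt -h permKV.
have lth u : exists v, th (lift ord0 u) = lift ord0 v.
  case: (unliftP ord0 (th (lift ord0 u))) => [v ->|h]; first by exists v.
  by have := neq_lift ord0 u; rewrite -(thK (lift ord0 u)) h th0 eqxx.
(* The default [u] is never taken: [th] fixes the apex and is injective, so it sends base vertices
   to base vertices. *)
pose f u := odflt u (unlift ord0 (th (lift ord0 u))).
have fE u : lift ord0 (f u) = th (lift ord0 u).
  by have [v h] := lth u; rewrite /f h liftK.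
have fK : involutive f by move=> u; apply: (@lift_inj _ ord0); rewrite !fE thK.
exists (perm (inv_inj fK)); split=> [u v|u|u]; rewrite !permE.
- have := thW (lift ord0 u) (lift ord0 v); rewrite -!fE !cone_lift.
  by case: (e _ _); case: (e _ _).
- by rewrite fK.
- apply/eqP => h; have := neq_lift ord0 u.
  by rewrite (thfix (lift ord0 u)) ?eqxx // -fE h.
Qed.

End Reflections.

Section Involution.
Variables (n : nat) (tau : 'S_n).
Hypotheses (tauK : forall v, tau (tau v) = v) (tau_fix : forall v, tau v != v).

(** One vertex, the smaller one, from each orbit of the involution. *)
Definition ascents : seq 'I_n := [seq u : 'I_n <- enum 'I_n | (u < tau u)%N].

Lemma uniq_ascents : uniq (ascents ++ rev (map tau ascents)).
Proof.
rewrite cat_uniq rev_uniq map_inj_uniq; last exact: perm_inj.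
rewrite filter_uniq ?enum_uniq //= andbT -all_predC; apply/allP => v.
rewrite mem_rev => /mapP[u]; rewrite !mem_filter => /andP[h _] -> /=.
by rewrite mem_filter tauK mem_enum andbT -leqNgt ltnW.
Qed.

Lemma size_ascents : n = (size ascents + size ascents)%N.
Proof.
have mem : ascents ++ rev (map tau ascents) =i enum 'I_n.
  move=> v; rewrite mem_enum mem_cat mem_rev.
  have [h|h|h] := ltngtP v (tau v).
  - by rewrite mem_filter h mem_enum.
  - apply/orP; right; apply/mapP; exists (tau v); last by rewrite tauK.
    by rewrite mem_filter tauK h mem_enum.
  - by case/eqP: (tau_fix v); apply: val_inj; rewrite /= -h.
have/perm_size := uniq_perm uniq_ascents (enum_uniq 'I_n) mem.
rewrite size_cat size_rev size_map size_enum_ord; exact: esym.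
Qed.

Lemma fpf_involution_even : ~~ odd n.
Proof. by have := congr1 odd size_ascents; rewrite oddD addbb => ->. Qed.

End Involution.

Section Reflection.
Variables (k : nat) (e : rel 'I_k.+1) (tau : 'S_k.+1).
Local Notation n := k.+1.
Local Notation N := k.+2.
Local Notation Z := 'I_k.+2.
Hypothesis tau_aut : fpf_involutory_automorphism e tau.

Let tauK : forall v, tau (tau v) = v. Proof. by case: tau_aut. Qed.
Let tau_fix : forall v, tau v != v. Proof. by case: tau_aut. Qed.

Let S := ascents tau.
(** The symmetric labeling: the apex, the representatives of the orbits, then their partners in
    reverse order, so that positions [i] and [N - i] hold vertices exchanged by [tau]. *)
Let s : seq Z := ord0 :: map (lift ord0) (S ++ rev (map tau S)).
Let T : 'S_N := lift_perm ord0 ord0 tau.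

Let size_s : size s = N.
Proof.
by rewrite /= size_map size_cat size_rev size_map -(size_ascents tauK tau_fix).
Qed.

Let uniq_s : uniq s.
Proof.
rewrite /= map_inj_uniq ?uniq_ascents //; last exact: lift_inj.
by rewrite andbT; apply/mapP => -[u _ /eqP]; rewrite eq_liftF.
Qed.

Let p_inj : injective (fun x : Z => nth ord0 s x).
Proof.
by move=> x y /eqP; rewrite nth_uniq ?size_s // => /eqP; exact: val_inj.
Qed.

Lemma cone_lift_perm i j : cone e (T i) (T j) = cone e i j.
Proof.
have [taue _ _] := tau_aut.
case: (unliftP ord0 i) => [u ->|->]; case: (unliftP ord0 j) => [v ->|->];
  rewrite ?lift_perm_lift ?lift_perm_id // ?cone_lift ?taue //.
- by rewrite !cone_apexr.
- by rewrite !cone_apexl.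
Qed.

Lemma reflection_of_involution : exists p : 'S_N, p 0 = ord0 /\
  forall x y, cone e (p (- x)) (p (- y)) = cone e (p x) (p y).
Proof.
exists (perm p_inj); split; first by rewrite permE.
suff h x : perm p_inj (- x) = T (perm p_inj x) by move=> x y; rewrite !h cone_lift_perm.
have sz := size_ascents tauK tau_fix; rewrite -/S in sz.
have TK y : T (T y) = y.
  by case: (unliftP ord0 y) => [u ->|->];
    rewrite ?lift_perm_lift ?tauK // !lift_perm_id.
have low (y : Z) : (0 < y <= size S)%N -> perm p_inj (- y) = T (perm p_inj y).
  move=> /andP[y0 yS]; rewrite ![perm p_inj _]permE.
  have -> : (- y : Z) = (N - y)%N :> nat by rewrite /= modn_small //; lia.
  (* Here [N] is twice [size S] plus one; the successor skips the apex and the first [size S] the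
     representatives. *)
  have -> : (N - y = (size S + (size S - y)).+1)%N by lia.
  rewrite -[y : nat]prednK //.
  have [m0|u0] : (size S = 0)%N \/ exists u0 : 'I_n, true by right; exists ord0.
    lia.
  case: u0 => u0 _.
  rewrite /s /= !(nth_map u0) ?size_cat ?size_rev ?size_map; try lia.
  rewrite !nth_cat ltnNge leq_addr /= addKn ifT; last lia.
  rewrite nth_rev ?size_map; last lia.
  rewrite (nth_map u0); last lia.
  by rewrite lift_perm_lift; do 3 congr (_ _); lia.
have [x0|x0] := posnP x.
  have -> : x = 0 by exact: val_inj.
  by rewrite oppr0 permE /= lift_perm_id.
have [xS|Sx] := leqP x (size S); first by apply: low; rewrite x0.
(* A position in the second half is the opposite of one in the first, and [T] is an involution. *)
rewrite -{2}[x]opprK (low (- x)) ?TK //.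
by rewrite /= modn_small; have := ltn_ord x; lia.
Qed.

End Reflection.

(** * The Fourier ratio of a cone *)

Section FRatio.
Variables (R : realType) (k : nat).
Local Notation N := k.+2.
Local Notation Z := 'I_k.+2.
Local Notation P := (Z * Z)%type.
Implicit Types (W : 'M[nat]_N) (p : 'S_N) (t : Z).

Definition labelled W p t (q : P) : nat := W (p (q.1 + t)) (p (q.2 + t)).

Lemma dft_relabel W p r v :
  (dft R N *m relabel R W p *m dft R N) r v =
  (N%:R^-1)%:C * fourier2 (fun q => (labelled W p 0 q)%:R) (r, v).
Proof.
have psiE (a b : Z) : dft R N a b = ((Num.sqrt N%:R)^-1)%:C * psi R (a * b).
  by rewrite mxE psiM.
have sN : (Num.sqrt N%:R)^-1 * (Num.sqrt N%:R)^-1 = N%:R^-1 :> R.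
  by rewrite -invfM -expr2 sqr_sqrtr // ler0n.
rewrite mxE /fourier2 mulr_sumr.
rewrite (sum_pairE (fun x y => (N%:R^-1)%:C *
  (((labelled W p 0 (x, y))%:R : R)%:C * psi2 R (r, v) (x, y)))).
rewrite exchange_big; apply: eq_bigr => y _.
rewrite [(_ *m relabel R W p) r y]mxE mulr_suml; apply: eq_bigr => x _.
rewrite !psiE [relabel R W p x y]mxE -sN rmorphM /= /labelled /= !addr0.
rewrite rmorph_nat /psi2 psiD /= [v * y]mulrC.
by move: (_^-1%:C) (psi R _) (psi R _) => a b c; ring.
Qed.

Lemma labelled_shift W p t (r : P) :
  normc (fourier2 (fun q => (labelled W p t q)%:R) r) =
  normc (fourier2 (fun q => (labelled W p 0 q)%:R : R) r).
Proof.
have -> : fourier2 (fun q => (labelled W p t q)%:R) r =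
    psi2 R r (- (t, t)) * fourier2 (fun q => (labelled W p 0 q)%:R : R) r.
  rewrite /fourier2 mulr_sumr (reindex (fun q : P => q - (t, t))) /=.
    apply: eq_bigr => q _; rewrite mulrCA; congr (_ * _).
      by rewrite /labelled /= !subrK !addr0.
    by rewrite /psi2 -psiD; congr psi => /=; ring.
  by exists (fun q : P => q + (t, t)) => q _; rewrite ?subrK ?addrK.
by rewrite normcM normc_psi mul1r.
Qed.

Lemma sum_labelled (V : nmodType) (g : nat -> V) W p t :
  \sum_q g (labelled W p t q) = \sum_i \sum_j g (W i j).
Proof.
rewrite (sum_pairE (fun x y => g (W (p (x + t)) (p (y + t))))).
have bij : {on [pred _ | true], bijective (fun x : Z => p (x + t))}.
  by exists (fun i => (p^-1)%g i - t) => x _; rewrite ?permK ?addrK ?subrK ?permKV.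
rewrite [RHS](reindex _ bij); apply: eq_bigr => x _.
by rewrite [RHS](reindex _ bij).
Qed.

(** The denominator becomes the Frobenius norm of the weights, by Parseval's identity, and no longer
    depends on [p]; the shift [t] can be chosen freely to bring the apex to 0. *)
Lemma FR_labelled W p t :
  FR R W p = (\sum_r normc (fourier2 (fun q => (labelled W p t q)%:R : R) r)) /
    (N%:R * Num.sqrt (\sum_i \sum_j (W i j)%:R ^+ 2)).
Proof.
rewrite invfM mulrA [X in X / _]mulrC.
have N0 : 0 < N%:R^-1 :> R by rewrite invr_gt0 ltr0n.
pose D := fourier2 (fun q => (labelled W p 0 q)%:R : R).
have nE r v : normc ((dft R N *m relabel R W p *m dft R N) r v) =
    N%:R^-1 * normc (D (r, v)).
  by rewrite dft_relabel normcM normc_real ger0_norm // ltW.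
rewrite /FR; congr (_ / _).
  rewrite /norm1; rewrite (eq_bigr _ (fun r _ => labelled_shift W p t r)).
  rewrite -(pair_bigA _ (fun r v => normc (D (r, v)))) /= mulr_sumr.
  apply: eq_bigr => r _; rewrite mulr_sumr; apply: eq_bigr => v _.
  exact: nE.
rewrite /norm2; congr Num.sqrt.
transitivity (N%:R ^- 2 * \sum_q normc (D q) ^+ 2).
  rewrite -(pair_bigA _ (fun r v => normc (D (r, v)) ^+ 2)) /= mulr_sumr.
  apply: eq_bigr => r _; rewrite mulr_sumr; apply: eq_bigr => v _.
  by rewrite nE exprMn exprVn.
rewrite parseval mulrA mulVf ?mul1r; last by rewrite expf_neq0 // pnatr_eq0.
exact: (sum_labelled (fun m => m%:R ^+ 2)).
Qed.

End FRatio.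

Section Decision.
Variables (R : realType) (k : nat) (e : rel 'I_k.+1).
Local Notation n := k.+1.
Local Notation N := k.+2.
Local Notation Z := 'I_k.+2.
Local Notation P := (Z * Z)%type.
Hypotheses (e_sym : symmetric e) (e_irr : irreflexive e) (n_even : ~~ odd n).
Local Notation Nr := (N%:R : R).
Local Notation W := (cone e).
Implicit Types (p : 'S_N) (t : Z).

Let E : nat := \sum_(u < n) \sum_(v < n) e u v.
Let S : R := \sum_i \sum_j (W i j)%:R ^+ 2.
Let A : R := 4 * Nr ^+ 2 * (Nr - 1) ^+ 2 - 2 * E%:R.

Let N3 : (2 < N)%N. Proof. by move: n_even; case: k. Qed.

Lemma cone_like_labelled p t : p t = ord0 -> cone_like (labelled W p t).
Proof.
move=> pt; have p0 x : x != 0 -> p (x + t) != ord0.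
  apply: contra_neq => h; apply: (addIr t); rewrite add0r.
  by apply: (@perm_inj _ p); rewrite pt.
split=> [x y|x|y y0|x y x0 y0]; rewrite /labelled /=.
- exact: coneC.
- exact: cone_irr.
- rewrite add0r pt; case: (unliftP ord0 (p (y + t))) (p0 _ y0) => [v ->|-> /eqP//].
  by rewrite cone_apexl.
- case: (unliftP ord0 (p (x + t))) (p0 _ x0) => [u ->|-> /eqP//] _.
  case: (unliftP ord0 (p (y + t))) (p0 _ y0) => [v ->|-> /eqP//] _.
  by rewrite cone_lift; case: (e u v).
Qed.

Lemma sum_base p t : p t = ord0 -> \sum_q base R (labelled W p t) q = E%:R.
Proof.
move=> pt; have cl := cone_like_labelled pt.
have : \sum_q (labelled W p t q)%:R = 2 * n%:R * Nr ^+ 2 + E%:R :> R.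
  rewrite (sum_labelled (fun m => m%:R : R)) (sum_cone _ (fun m => m%:R : R)).
  rewrite natrM /E natr_sum add0r -mulr_natl -expr2.
  under [X in _ = _ + X]eq_bigr do rewrite natr_sum.
  by ring.
rewrite (eq_bigr _ (fun q _ => cone_decomp R cl q)) big_split /= -mulr_sumr.
rewrite sumrB big_split /= -mulr_sumr sum_ind1 sum_ind2 sum_ind0.
have -> : N%:R = n%:R + 1 :> R by rewrite natr1.
lra.
Qed.

Lemma cone_norm1E p t : p t = ord0 -> cone_norm1 R (labelled W p t) = A.
Proof. by move=> pt; rewrite /cone_norm1 sum_base. Qed.

Lemma edges_le : E%:R <= (Nr - 1) ^+ 2.
Proof.
have p0 : (1%g : 'S_N) ord0 = ord0 by rewrite perm1.
by rewrite -(sum_base p0); exact: sum_base_le (cone_like_labelled p0).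
Qed.

Lemma sum_sqr_cone : S = 2 * n%:R * Nr ^+ 4 + E%:R.
Proof.
rewrite /S (sum_cone _ (fun m => m%:R ^+ 2 : R)) expr0n add0r natrM /E natr_sum.
rewrite -mulr_natl; under [X in _ = _ + X]eq_bigr do rewrite natr_sum.
have -> : \sum_u \sum_v (e u v)%:R ^+ 2 = \sum_(u < n) \sum_(v < n) (e u v)%:R :> R.
  by apply: eq_bigr => u _; apply: eq_bigr => v _; case: (e u v); rewrite ?expr1n ?expr0n.
by ring.
Qed.

(** [S] is at most [2 * N ^ 5], so the product is at most the square root of 2 divided by [256 * N];
    the bound replaces that root by 3/2. *)
Lemma delta_norm2 : delta R N * Num.sqrt S <= 3 / (512 * Nr).
Proof.
have N0 : 0 < Nr by rewrite ltr0n.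
have Sle : S <= 2 * Nr ^+ 5.
  rewrite sum_sqr_cone; have := edges_le.
  have -> : n%:R = Nr - 1 :> R by rewrite -[Nr]natr1 addrK.
  have r3 : 3 <= Nr by rewrite ler_nat.
  move: (E%:R) Nr N0 r3 => x r r0 r3 xr.
  have h1 : 1 <= r ^+ 2 by nra.
  have h2 : r ^+ 2 <= r ^+ 4.
    have -> : r ^+ 4 = r ^+ 2 * r ^+ 2 by rewrite -exprD.
    by rewrite ler_peMr // sqr_ge0.
  rewrite (exprSr r 4); nra.
have -> : delta R N = (256 * (Nr ^+ 3 * Num.sqrt Nr))^-1.
  rewrite /delta; congr (_ * _)^-1.
  have -> : 7 / 2 = 3%:R + 2^-1 :> R by lra.
  rewrite powRD; last by rewrite (gt_eqF N0) implybT.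
  by rewrite powR_mulrn ?powR12_sqrt // ltW.
have q0 : 0 < Num.sqrt Nr by rewrite sqrtr_gt0.
have c0 : 0 < 256 * (Nr ^+ 3 * Num.sqrt Nr) by rewrite !mulr_gt0 // exprn_gt0.
rewrite mulrC ler_pdivrMr // mulrAC ler_pdivlMr ?mulr_gt0 //.
have -> : 3 * (256 * (Nr ^+ 3 * Num.sqrt Nr)) = (512 * Nr) * (3 / 2 * Nr ^+ 2 * Num.sqrt Nr).
  by move: Nr (Num.sqrt Nr) => r q; field.
rewrite mulrC ler_pM2l ?mulr_gt0 //.
have r0 : 0 <= 3 / 2 * Nr ^+ 2 * Num.sqrt Nr.
  by apply: mulr_ge0 (ltW q0); apply: mulr_ge0 (sqr_ge0 _); lra.
rewrite -(ger0_norm r0) -sqrtr_sqr ler_sqrt; last exact: sqr_ge0.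
have -> : (3 / 2 * Nr ^+ 2 * Num.sqrt Nr) ^+ 2 = 9 / 4 * (Nr ^+ 4 * Nr).
  have := sqr_sqrtr (ltW N0); move: (Num.sqrt Nr) => q; move: Nr => r qr.
  by transitivity (9 / 4 * (r ^+ 4 * q ^+ 2)); [field | rewrite qr].
apply: le_trans Sle _; rewrite (exprSr Nr 4) ler_wpM2r //; last by lra.
by rewrite mulr_ge0 ?exprn_ge0 // ltW.
Qed.

Let s0 : 0 < Num.sqrt S.
Proof.
rewrite sqrtr_gt0 sum_sqr_cone ltr_wpDr // ?ler0n // !mulr_gt0 ?ltr0n //.
Qed.

Lemma FRmin_involution (tau : 'S_n) : fpf_involutory_automorphism e tau ->
  FRmin R W * (Nr * Num.sqrt S) <= A.
Proof.
move=> /reflection_of_involution [p [p0 sy]].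
have N0 : 0 < Nr by rewrite ltr0n.
have := bigmin_le (FR R W 1%g) p (fun p => FR R W p); rewrite -/(FRmin R W) => h.
rewrite -ler_pdivlMr ?mulr_gt0 //; apply: le_trans h _.
rewrite (FR_labelled R W p 0) (cone_norm1_symmetric R (cone_like_labelled p0) N3) //.
  by rewrite (cone_norm1E p0).
by case=> x y; rewrite /labelled /= !addr0 sy.
Qed.

Lemma FRmin_no_involution :
  (forall tau : 'S_n, ~ fpf_involutory_automorphism e tau) ->
  A + 1 / 64 <= FRmin R W * (Nr * Num.sqrt S).
Proof.
move=> notau; have N0 : 0 < Nr by rewrite ltr0n.
rewrite -ler_pdivrMr ?mulr_gt0 //.
have h p : (A + 1 / 64) / (Nr * Num.sqrt S) <= FR R W p.
  pose t := (p^-1)%g ord0; have pt : p t = ord0 by rewrite permKV.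
  rewrite (FR_labelled R W p t) ler_pM2r ?invr_gt0 ?mulr_gt0 //.
  rewrite -(cone_norm1E pt); apply: cone_norm1_asymmetric => //.
    exact: cone_like_labelled.
  apply: contrapT => /forallNP nq.
  have [|tau] := @involution_of_reflection k e n_even p t pt; last exact: notau.
  by move=> x y; have /negP/negPn/eqP := nq (x, y); rewrite /labelled.
by apply/bigmin_geP; split=> [|p _]; exact: h.
Qed.

(** Multiplied by [Nr * s], the error is at most 3/512. This is less than 1/128, half of the gap
    1/64, so the threshold [A + 1 / 128] separates the two cases. *)
Lemma decision (a : int) (d : nat) : (0 < d)%N ->
  `|a%:~R / d%:R - FRmin R W| <= delta R N ->
  (exists tau : 'S_n, fpf_involutory_automorphism e tau) <->
  (a < 0) || (`|a| ^ 2 * test_coef n E <= d ^ 2 * test_bound n E ^ 2)%N.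
Proof.
move=> d0 ap; have N0 : 0 < Nr by rewrite ltr0n.
have dr0 : 0 < d%:R :> R by rewrite ltr0n.
have r3 : 3 <= Nr by rewrite ler_nat.
have dl := delta_norm2; have el := edges_le.
set s := Num.sqrt S in dl *.
have sS : s ^+ 2 = S by rewrite sqr_sqrtr // sum_sqr_cone addr_ge0 ?ler0n //
  !mulr_ge0 ?exprn_ge0 ?ler0n.
have A0 : 0 <= A.
  rewrite /A; move: (E%:R) Nr N0 r3 el => x r r0 r3 xr; nra.
have boundE : (test_bound n E)%:R = 128 * A + 1 :> R.
  have n1 : n%:R = Nr - 1 :> R by rewrite -[Nr]natr1 addrK.
  (* The subtraction in [test_bound] is truncated; the bound on [E] ensures that nothing is cut
     off. *)
  rewrite /test_bound natrD natrM natrB.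
    by rewrite !natrM n1 /A; ring.
  rewrite -(ler_nat R) !natrM n1.
  move: (E%:R) Nr N0 r3 el => x r r0 r3 xr; nra.
have coefE : (test_coef n E)%:R = (128 * Nr * s) ^+ 2 :> R.
  by rewrite /test_coef !(natrM, natrD) exprMn sS sum_sqr_cone; ring.
have natr2 m : (m ^ 2)%:R = m%:R ^+ 2 :> R by rewrite natrX.
have testE : (`|a| ^ 2 * test_coef n E <= d ^ 2 * test_bound n E ^ 2)%N =
    (`|a|%N%:R * (128 * Nr * s) <= d%:R * (128 * A + 1) :> R).
  rewrite -(ler_nat R) (natrM R (`|a| ^ 2)) (natrM R (d ^ 2)) coefE.
  rewrite !natr2 boundE -!exprMn ler_pXn2r // nnegrE !mulr_ge0 ?ler0n //.
    by rewrite ltW.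
  by rewrite addr_ge0 // mulr_ge0.
have apN : `|a%:~R * (Nr * s) - d%:R * (FRmin R W * (Nr * s))| <= d%:R * (3 / 512).
  have -> : a%:~R * (Nr * s) - d%:R * (FRmin R W * (Nr * s)) =
      (a%:~R / d%:R - FRmin R W) * (d%:R * (Nr * s)) :> R.
    move: dr0; move: (d%:R) (a%:~R) => y x y0; move: Nr => r; field; lra.
  have c0 : 0 <= d%:R * (Nr * s) by rewrite !mulr_ge0 ?ler0n // ltW.
  rewrite normrM (ger0_norm c0); apply: le_trans (ler_wpM2r c0 ap) _.
  have -> : delta R N * (d%:R * (Nr * s)) = d%:R * (Nr * (delta R N * s)) by ring.
  rewrite ler_pM2l // mulrC -ler_pdivlMr //; apply: le_trans dl _.
  by rewrite invfM mulrA.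
rewrite ler_norml in apN; case/andP: apN => ap1 ap2.
have yes tau : fpf_involutory_automorphism e tau ->
    a%:~R * (128 * Nr * s) <= d%:R * (128 * A + 1) :> R.
  move=> /FRmin_involution; rewrite -/s; move: ap1 ap2 dr0.
  move: (FRmin R W) (d%:R) (a%:~R) => m y x; nra.
have no : (forall tau : 'S_n, ~ fpf_involutory_automorphism e tau) ->
    d%:R * (128 * A + 1) < a%:~R * (128 * Nr * s) :> R.
  move=> /FRmin_no_involution; rewrite -/s; move: ap1 ap2 dr0.
  move: (FRmin R W) (d%:R) (a%:~R) => m y x; nra.
have [a0|a0] /= := ltP a 0.
  split=> // _; apply: contrapT => /forallNP /no.
  have : a%:~R < 0 :> R by rewrite ltrz0.
  have : 0 <= d%:R * (128 * A + 1) by rewrite mulr_ge0 ?ler0n // addr_ge0 // mulr_ge0.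
  have : 0 <= 128 * Nr * s by rewrite !mulr_ge0 ?ler0n // ltW.
  nra.
have aE : a%:~R = `|a|%N%:R :> R by rewrite natr_absz ger0_norm.
rewrite testE -aE; split=> [[tau]|h]; first exact: yes.
by apply: contrapT => /forallNP /no; rewrite ltNge h.
Qed.

End Decision.

(** * The reduction *)

Local Close Scope complex_scope.
Local Close Scope ring_scope.

Record cone_base_graph (n : nat) (e : rel 'I_n) : Prop := ConeBaseGraph {
  base_nonempty : 0 < n;
  base_even : ~~ odd n;
  base_sym : symmetric e;
  base_irr : irreflexive e }.

(* Invalid inputs are replaced by the code of an admissible graph, so that the
   approximation algorithm is only run on matrices on which it is specified. *)
Definition normalize (x : bits) : bits :=
  if valid x then x else enc_graph (fun _ _ : 'I_2 => false).

Lemma normalizeP x : exists n (e : rel 'I_n),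
  cone_base_graph e /\ normalize x = enc_graph e.
Proof.
rewrite /normalize; case: validP => [[n [e [? ? ? ? ->]]]|_]; first by exists n, e.
by exists 2, (fun _ _ => false).
Qed.

(** The two relations live on types that are not convertible, so their equality is expressed as the
    transfer of an arbitrary property. *)
Lemma enc_graph_inj n n' (e : rel 'I_n) (e' : rel 'I_n') (T : forall m, rel 'I_m -> Prop) :
  enc_graph e = enc_graph e' -> T n e -> T n' e'.
Proof.
move=> h; have nn : n = n' by rewrite -(order_enc e) h order_enc.
subst n'; suff -> : e = e' by [].
by apply: funext => u; apply: funext => v; rewrite -(adj_enc e) h adj_enc.
Qed.

Lemma PT_normalize G {cG : ctx G} (x : G -> bits) :
  PT x -> PT (fun g => normalize (x g)).
Proof. by move=> px; exact: PT_if (PT_valid px) px (PT_const _). Qed.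

Lemma in_P_of_oracle (R : realType) (g : bits -> bits) :
  PT (fun p : unit * bits => g p.2) ->
  (forall x n (e : rel 'I_n), cone_base_graph e -> normalize x = enc_graph e ->
     approximates R (cone e) (g x)) ->
  in_P fpf_involution_problem.
Proof.
move=> pg gP.
have acc n (e : rel 'I_n) : cone_base_graph e ->
    (exists tau : 'S_n, fpf_involutory_automorphism e tau) <->
    accepts (enc_graph e) (g (enc_graph e)).
  move=> ce; have [n0 nodd sym irr] := ce.
  have nE : normalize (enc_graph e) = enc_graph e.
    by rewrite /normalize ifT //; apply/validP; exists n, e.
  have [a [d [d0 -> ap]]] := gP _ _ _ ce nE; rewrite accepts_frac.
  case: n e {ce nE} n0 nodd sym irr ap => // k e _ nodd sym irr ap.
  exact: decision ap.
(* The word [[:: false]] codes the graph without vertices, for which the empty permutation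
   qualifies; it is accepted apart since it is not [valid]. *)
exists (fun x => [:: (size x == 1) && ~~ head false x || valid x && accepts x (g x)]).
  apply: PT_polytime; apply: PT_seq1.
  have px : PT (fun p : unit * bits => p.2) by exact: PT_last.
  apply: PT_or; last exact: PT_and (PT_valid px) (PT_accepts px pg).
  exact: PT_and (PT_eqn (PT_size_bits px) (PT_const 1)) (PT_neg (PT_head px)).
move=> x; split=> [[n [e [sym irr -> [tau tauP]]]]|[]].
  have nodd : ~~ odd n by case: tauP => _ h1 h2; exact: fpf_involution_even h1 h2.
  have [n0|n0] := posnP n.
    by subst n; rewrite /= size_allpairs -!cardE card_ord.
  have ce : cone_base_graph e by split.
  congr [:: _]; apply/orP; right; apply/andP; split.
    by apply/validP; exists n, e.
  by apply/(acc _ _ ce); exists tau.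
case/orP => [/andP[/eqP sx hx]|/andP[/validP[n [e [n0 nodd sym irr ->]]] h]].
  exists 0, (fun _ _ => false); split=> //.
    rewrite /enc_graph; have -> : enum 'I_0 = [::].
      by apply: size0nil; rewrite -cardE card_ord.
    by case: x sx hx => [|[] [|]].
  by exists 1%g; split=> // -[].
have ce : cone_base_graph e by split.
by exists n, e; split=> //; apply/(acc _ _ ce).
Qed.

(** The output of a solver is given only existentially. Since [normalize] turns every word into an
    admissible instance, choice yields a total function [g], which [PT_runs] makes polynomial-time.
    The property [Q] stands for approximation or for exact denotation. *)
Lemma PT_solver (c : cmd) (k : nat) (h : bits -> bits) (Q : forall N, 'M[nat]_N -> bits -> Prop) :
  PT (fun p : unit * bits => h p.2) ->
  (forall x n (e : rel 'I_n), cone_base_graph e -> normalize x = enc_graph e ->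
     exists2 y, runs c k (h x) y & Q n.+1 (cone e) y) ->
  exists g : bits -> bits, PT (fun p : unit * bits => g p.2) /\
    forall x n (e : rel 'I_n), cone_base_graph e -> normalize x = enc_graph e ->
      Q n.+1 (cone e) (g x).
Proof.
move=> ph hP.
have /choice[g gP] : forall x, exists y, runs c k (h x) y /\
    forall n (e : rel 'I_n), normalize x = enc_graph e -> Q n.+1 (cone e) y.
  move=> x; have [n [e [ce xe]]] := normalizeP x.
  have [y ry Qy] := hP _ _ _ ce xe; exists y; split=> // n' e' xe'.
  by apply: (@enc_graph_inj _ _ e e' (fun m e => Q m.+1 (cone e) y)); rewrite -?xe.
exists g; split; first by apply: PT_runs ph _ => p; exact: (gP p.2).1.
by move=> x n e _; exact: (gP x).2.
Qed.

Section Solvers.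
Variables (R : realType) (K : mx_class).
(** The cones are restricted matrices, so one argument serves every class that contains these. *)
Hypothesis subK : forall N (W : 'M[nat]_N), restricted_adjacency W -> K W.

Let PT_instance : PT (fun p : unit * bits => cone_code (normalize p.2)).
Proof. exact: PT_cone_code (PT_normalize PT_last). Qed.

Let instance_in x n (e : rel 'I_n) : cone_base_graph e -> normalize x = enc_graph e ->
  K (cone e) /\ cone_code (normalize x) = enc_mx (cone e).
Proof.
move=> [n0 nodd sym irr] ->; rewrite cone_code_enc; split=> //.
exact/subK/cone_restricted.
Qed.

Lemma in_P_of_approximable : approximable R K -> in_P fpf_involution_problem.
Proof.
case=> c [k ck]; have [|g [pg gP]] :=
    @PT_solver c k (fun x => cone_code (normalize x))
      (fun N W y => approximates R W y) PT_instance.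
  by move=> x n e ce xe; have [KW ->] := instance_in ce xe; exact: ck.
exact: in_P_of_oracle pg gP.
Qed.

(** Two solvers are chained: the exact output [z] is paired with the instance and handed to the
    program that extracts an approximation. *)
Lemma in_P_of_exact (den : bits -> option R) : permits_approximation den K ->
  exactly_computable den K -> in_P fpf_involution_problem.
Proof.
case=> c2 [k2 ck2] [c1 [k1 ck1]].
have [|z [pz zP]] := @PT_solver c1 k1 (fun x => cone_code (normalize x))
    (fun N W z => den z = Some (FRmin R W)) PT_instance.
  by move=> x n e ce xe; have [KW ->] := instance_in ce xe; exact: ck1.
have [| |g [pg gP]] := @PT_solver c2 k2
    (fun x => enc_pair (cone_code (normalize x)) (z x))
    (fun N W y => approximates R W y).
- exact: PT_cat (PT_delim PT_instance) pz.
- move=> x n e ce xe; have [KW ->] := instance_in ce xe.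
  by apply: ck2 => //; exact: zP.
exact: in_P_of_oracle pg gP.
Qed.

End Solvers.

Theorem theorem5p1 (R : realType)
    (Lubiw : NP_complete fpf_involution_problem) :
  [/\ NP_hard (approximable R weighted_adjacency),
      NP_hard (approximable R restricted_adjacency),
      forall den : seq bool -> option R,
        permits_approximation den weighted_adjacency ->
        NP_hard (exactly_computable den weighted_adjacency)
    & forall den : seq bool -> option R,
        permits_approximation den restricted_adjacency ->
        NP_hard (exactly_computable den restricted_adjacency)].
Proof.
have sub N (W : 'M[nat]_N) : restricted_adjacency W -> weighted_adjacency W by case.
split=> [||den perm|den perm]; exists fpf_involution_problem => //.
- exact: in_P_of_approximable.
- exact: in_P_of_approximable.
- exact: in_P_of_exact perm.
- exact: in_P_of_exact perm.
Qed.
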